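(* Let $0<\varepsilon<1/3$. There exist constants $c,c'>0$ depending only on $\varepsilon$ such that for all $d\ge3$ and all $x\in\mathbb{H}=\{0,1\}^d$, \[ \mathbb{P}\big[\text{some neighbour of }x\text{ is contained in a substantial component of }\mathbb{H}\cap E_\varphi^{\ge h_{\mathrm{as}}(d)(1-2\varepsilon)}\big]\ge1-ce^{-c'd^\varepsilon}. \]
   Context: Under $\mathbb{P}$, $\varphi$ is the Gaussian free field on $\mathbb{Z}^d$ ($d\ge3$): centered Gaussian with covariance the Green function $g(x,y)=\sum_{n\ge0}P_x[X_n=y]$ of simple random walk; $h_{\mathrm{as}}(d)=\sqrt{2g(0,0)\log d}$ and $E_\varphi^{\ge h}=\{x:\varphi_x\ge h\}$. Neighbours are with respect to the nearest-neighbour graph ($|y-x|_1=1$). Let $b=b(\varepsilon)=1+11/\varepsilon$. For $K\subset\mathbb{Z}^d$, a substantial component of $K$ is a (nearest-neighbour) connected subset $C$ of $K$ containing at least $\lfloor d^\varepsilon/b\rfloor^{b-1}$ points. *)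

(* Defs.v *)
From HB Require Import structures.
From mathcomp Require Import all_boot all_order all_algebra.
From mathcomp Require Import all_classical all_reals all_analysis.
Set Implicit Arguments. Unset Strict Implicit. Unset Printing Implicit Defensive.
Import Order.TTheory GRing.Theory Num.Theory.
Local Open Scope classical_set_scope.
Local Open Scope ring_scope.

Definition zpoint (d : nat) := {ffun 'I_d -> int}.

Definition origin (d : nat) : zpoint d := [ffun=> 0].

Definition nbr (d : nat) (x y : zpoint d) : bool :=
  \sum_(i < d) `|x i - y i| == 1.

Definition shift (d : nat) (x : zpoint d) (i : 'I_d) (s : int) : zpoint d :=
  [ffun j => if j == i then x j + s else x j].

Fixpoint srw_p (R : realType) (d : nat) (n : nat) (x y : zpoint d) : R :=
  match n with
  | 0 => (x == y)%:R
  | n'.+1 => (d.*2)%:R^-1 *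
      \sum_(i < d) (srw_p R n' (shift x i 1) y + srw_p R n' (shift x i (-1)) y)
  end.

(* Green function g(x,y) = sum_{n>=0} P_x[X_n = y]  (finite for d >= 3) *)
Definition green (R : realType) (d : nat) (x y : zpoint d) : R :=
  fine (\sum_(n <oo) (srw_p R n x y)%:E)%E.

Definition h_as (R : realType) (d : nat) : R :=
  Num.sqrt (2 * green R (origin d) (origin d) * ln d%:R).

Definition in_cube (d : nat) (x : zpoint d) : bool :=
  [forall i, (x i == 0) || (x i == 1)].

Definition gauss_law (R : realType) (v : R) (A : set R) : \bar R :=
  if v == 0 then \d_(0 : R) A else normal_prob 0 (Num.sqrt v) A.

(* phi is a Gaussian free field on Z^d under P: centered jointly Gaussian
   with covariance g, i.e. every finite linear combination sum a_x phi_x is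
   centered normal with variance sum_{x,y} a_x a_y g(x,y). *)
Definition is_GFF (R : realType) (d : nat) (dT : measure_display)
    (T : measurableType dT) (P : probability T R) (phi : zpoint d -> {RV P >-> R}) : Prop :=
  forall (s : seq (zpoint d)) (a : zpoint d -> R) (A : set R), measurable A ->
    P ((fun w => \sum_(x <- s) a x * phi x w) @^-1` A) =
    gauss_law (\sum_(x <- s) \sum_(y <- s) a x * a y * green R x y) A.

Definition bconst (R : realType) (eps : R) : R := 1 + 11 / eps.

(* a nearest-neighbour connected finite set of points (given as a uniq seq) *)
Definition nn_connected (d : nat) (C : seq (zpoint d)) : Prop :=
  forall u v, u \in C -> v \in C ->
    exists p : seq (zpoint d), [&& path (@nbr d) u p, last u p == v & all (mem C) p].

Definition substantial (R : realType) (eps : R) (d : nat) (K : zpoint d -> bool)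
    (C : seq (zpoint d)) : Prop :=
  [/\ uniq C, all K C, nn_connected C &
     ((Num.floor ((d%:R : R) `^ eps / bconst eps))%:~R `^ (bconst eps - 1)
        <= (size C)%:R)].

(* Main.v *)
(* Write [P] for the transition operator of the walk and [G] for the Green function. Since
   [(I - P) G = I], the field splits as [phi = zeta + P phi] where the innovations
   [zeta = phi - P phi] have covariance [I - P], so that on any set of pairwise non-adjacent
   points they are exactly i.i.d. standard normal, and where [P phi] has variance
   [g(0,0) - 1 <= 2 / d], so that [P phi >= -1] on polynomially many points outside an event of
   probability [exp (- c d)]. Split the coordinates into [K + 1] blocks, [K >= 11 / eps], and grow
   a tree from [x] whose [s]-th generation flips one coordinate of the [s]-th block. The children
   of a vertex are pairwise non-adjacent and each has [zeta] above the level with probability of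
   order at least [d ^ (2 eps - 1)] up to logarithms, so a given vertex has fewer than [d ^ eps]
   such children with probability exponentially small in [d ^ eps]. A union bound over the
   polynomially many tree vertices makes every vertex good, and a good tree contains a component
   with [d ^ (eps K)] points. Independence is used only through expectations of products of
   trigonometric polynomials, which the laws of the linear combinations determine. *)
Require Import Defs.
From HB Require Import structures.
From mathcomp Require Import all_boot all_order all_algebra.
From mathcomp Require Import all_classical all_reals all_analysis.
From mathcomp Require Import measurable_realfun.
From mathcomp Require Import zify ring lra.
Import Order.TTheory GRing.Theory Num.Theory.
Import numFieldNormedType.Exports.
Local Open Scope classical_set_scope.
Local Open Scope ring_scope.

Set Implicit Arguments.
Unset Strict Implicit.
Unset Printing Implicit Defensive.

(* MathComp-Analysis also has a [shift]. *)
Local Notation shift := Defs.shift.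

(** * The Gaussian characteristic function *)

Section GaussianChar.
Context {R : realType}.
Implicit Types s t x a b : R.
Notation mu := (@lebesgue_measure R).

(** The hypothesis on the field gives only the laws of scalar linear combinations. No joint law is
    built from them: indicators of high values are replaced by powers of a cosine, and products of
    these reduce to characteristic functions of linear forms. A power of a cosine is periodic, so it
    imitates such an indicator only on a bounded window. Values below the window are removed by a
    union bound; values above it are harmless, being high anyway. The exponents leave room for crude
    constants. The expected number of good children of a vertex is [d ^ (1 - (1 - 2 eps)^2)] up to
    lower order factors, and [(1 - 2 eps)^2 <= 1 - 8/3 eps] for [0 <= eps <= 1/3]. The excess over
    [d ^ (2 eps)] absorbs a raise of the level by three units: one for [P phi >= -1], one for the
    decay of the bump, one for its width. The vertex [x] itself may lie below the level. So the
    first of the [K + 1] generations only provides the neighbour of [x], and the other [K] provide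
    [N ^ K] points with [N >= d ^ eps], to be compared with the exponent [b - 1 = 11 / eps]. *)

Lemma normal_pdf_split s x : s != 0 ->
  normal_pdf 0 s x =
  Num.sqrt 2 * expR (- (x ^+ 2 / (4 * s ^+ 2))) * normal_pdf 0 (Num.sqrt 2 * s) x.
Proof.
move=> s0; have s20 : Num.sqrt 2 * s != 0 :> R.
  by rewrite mulf_neq0// gt_eqF// sqrtr_gt0.
rewrite !normal_pdfE//= /normal_peak /normal_fun !subr0 exprMn sqr_sqrtr//.
have -> : 2 * s ^+ 2 * pi *+ 2 = 2 * (s ^+ 2 * pi *+ 2) by ring.
rewrite sqrtrM// [(Num.sqrt 2 * _)^-1]invfM.
have q2 : Num.sqrt 2 != 0 :> R by rewrite gt_eqF// sqrtr_gt0.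
have -> : - x ^+ 2 / (s ^+ 2 *+ 2) = - (x ^+ 2 / (4 * s ^+ 2)) + - x ^+ 2 / (2 * s ^+ 2 *+ 2).
  by rewrite -(mulr_natl (s ^+ 2)) -(mulr_natl (2 * s ^+ 2)); field.
rewrite expRD; set p := (Num.sqrt (s ^+ 2 * _ *+ 2))^-1.
by field.
Qed.

(** Half of the Gaussian exponent is spent on decay in [t]; the other half is a normal density of
    deviation [sqrt 2 * s], of total mass 1. Tail bounds then need no tail integral, at the price of
    4 instead of 2 in the exponent. *)
Lemma normal_pdf_tail_split s t x : s != 0 -> 0 <= t -> t <= `|x| ->
  normal_pdf 0 s x <= Num.sqrt 2 * expR (- (t ^+ 2 / (4 * s ^+ 2))) * normal_pdf 0 (Num.sqrt 2 * s) x.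
Proof.
move=> s0 t0 tx; rewrite normal_pdf_split// ler_wpM2r ?normal_pdf_ge0//.
rewrite ler_wpM2l ?sqrtr_ge0// ler_expR lerN2 ler_wpM2r//.
  by rewrite invr_ge0 mulr_ge0// sqr_ge0.
by rewrite -[x ^+ 2]real_normK ?num_real// lerXn2r ?nnegrE.
Qed.

Lemma integral_normal_prob s f :
  measurable_fun [set: R] f -> (normal_prob 0 s).-integrable setT f ->
  (\int[normal_prob 0 s]_x f x = \int[mu]_x (f x * (normal_pdf 0 s x)%:E))%E.
Proof.
move=> mf intf.
rewrite -(Radon_Nikodym_change_of_variables (normal_prob_dominates 0 s))//=.
apply: ae_eq_integral => //.
- apply: emeasurable_funM => //; apply: (measurable_int mu).
  by apply: Radon_Nikodym_integrable; exact: normal_prob_dominates.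
- apply: emeasurable_funM => //=; apply/measurable_EFinP.
  exact: measurable_normal_pdf.
- apply: ae_eqe_mul2l => /=.
  (* The abstract derivative agrees with the density almost everywhere because both have the same
     integral over every measurable set. *)
  rewrite Radon_NikodymE//=; first exact: normal_prob_dominates.
  move=> abmu.
  case: cid => /= h [h1 h2 h3].
  apply: integral_ae_eq => //=.
  + by apply/measurable_EFinP; exact: measurable_normal_pdf.
  + by move=> E E01 mE; rewrite -h3.
Qed.

(** The fundamental theorem of calculus on [[-n, n]], followed by dominated convergence. It serves
    as integration by parts in [Fsin_cos]. *)
Lemma integral_derivative_eq0 (F f : R -> R) :
  continuous f -> (forall x, is_derive x 1 F (f x)) ->
  mu.-integrable setT (EFin \o f) ->
  F n%:R @[n --> \oo] --> 0 -> F (- n%:R) @[n --> \oo] --> 0 ->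
  \int[mu]_x f x = 0.
Proof.
move=> cf dF intf F1 F2.
pose I n := `[- n%:R, n%:R : R]%classic.
have mI n : measurable (I n) by exact: measurable_itv.
have mf : measurable_fun setT (EFin \o f) by exact: measurable_int intf.
have key : (\int[mu]_x ((EFin \o f) \_ (I n)) x)%E @[n --> \oo] --> (\int[mu]_x (f x)%:E)%E.
  apply: (@dominated_cvg _ _ _ mu setT measurableT (fun n => (EFin \o f) \_ (I n)) (EFin \o f) (abse \o (EFin \o f))) => /=.
  - by move=> n; apply/(measurable_restrictT _ (mI n)) => //; exact: measurable_funTS.
  - move=> x _; apply: cvg_near_cst.
    near=> n; rewrite patchE /I ifT// inE/= in_itv/= -ler_norml.
    near: n; exact: nbhs_infty_ger.
  - by [].
  - by apply: integrable_abse.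
  - by move=> n x _; rewrite patchE; case: ifP => //= _; rewrite normr0 lee_fin.
have {}key : (F n%:R - F (- n%:R))%:E @[n --> \oo] --> (\int[mu]_x (f x)%:E)%E.
  apply: cvg_trans key; apply: near_eq_cvg; near=> n.
  have n0 : (0 < n)%N by near: n; exact: nbhs_infty_gt.
  rewrite -integral_mkcond (@continuous_FTC2 _ f F) ?EFinB//.
  - by rewrite gtrN// ltr0n.
  - exact: continuous_subspaceT.
  - split => [x _||].
    + by have [] := dF x.
    + apply: cvg_at_right_filter; apply: differentiable_continuous; apply/derivable1_diffP.
      by have [] := dF (- n%:R).
    + apply: cvg_at_left_filter; apply: differentiable_continuous; apply/derivable1_diffP.
      by have [] := dF n%:R.
  - by move=> x _; rewrite derive1E; have [_ ->] := dF x.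
have : (F n%:R - F (- n%:R))%:E @[n --> \oo] --> (0 : \bar R)%E.
  by apply: cvg_EFin; [exact: nearW|rewrite -[0]subr0; exact: cvgB].
rewrite /Rintegral; move/(cvg_lim (@ereal_hausdorff R)) => h.
by move/(cvg_lim (@ereal_hausdorff R)): key; rewrite h => <-.
Unshelve. all: end_near. Qed.

Lemma abs_normal_pdf_ub s x : s != 0 ->
  `|x| * normal_pdf 0 s x <= Num.sqrt 2 * `|s| * normal_pdf 0 (Num.sqrt 2 * s) x.
Proof.
move=> s0; rewrite normal_pdf_split// [leLHS]mulrA ler_wpM2r ?normal_pdf_ge0//.
rewrite mulrCA ler_wpM2l ?sqrtr_ge0//.
rewrite expRN ler_pdivrMr ?expR_gt0//.
have s_gt0 : 0 < `|s| by rewrite normr_gt0.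
apply: (@le_trans _ _ (`|s| * (1 + x ^+ 2 / (4 * s ^+ 2)))); last first.
  by rewrite ler_wpM2l// expR_ge1Dx.
rewrite -[x ^+ 2]real_normK ?num_real// -[s ^+ 2]real_normK ?num_real//.
rewrite -subr_ge0.
(* After [1 + u <= expR u] the difference is a perfect square divided by [|s|]. *)
have -> : `|s| * (1 + `|x| ^+ 2 / (4 * `|s| ^+ 2)) - `|x| =
  (`|x| / 2 - `|s|) ^+ 2 / `|s| by field; rewrite gt_eqF.
by rewrite divr_ge0// ?sqr_ge0// ltW.
Qed.

Let integrable_pdf_bounded s (h : R -> R) c : s != 0 -> measurable_fun setT h ->
  (forall x, `|h x| <= c * normal_pdf 0 s x) -> mu.-integrable setT (EFin \o h).
Proof.
move=> s0 mh hc.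
apply: (@le_integrable _ _ _ mu setT measurableT _ (fun x => (c%:E * (normal_pdf 0 s x)%:E)%E)).
- exact/measurable_EFinP.
- move=> x _ /=; rewrite lee_fin (le_trans (hc x))//; exact: ler_norm.
- by apply: integrableZl => //; exact: integrable_normal_pdf.
Qed.

Lemma is_derive_normal_pdf s x : s != 0 ->
  is_derive x 1 (normal_pdf 0 s) (- (x / s ^+ 2) * normal_pdf 0 s x).
Proof.
move=> s0; rewrite normal_pdfE//.
have -> : (fun y => normal_peak s * normal_fun 0 s y) =
  normal_peak s *: (expR \o (fun y : R => (- (s ^+ 2 *+ 2)^-1) *: (y ^+ 2))).
  apply/funext => y /=; rewrite /normal_fun subr0; congr (_ * expR _).
  by rewrite mulNr [RHS]mulNr mulrC.
apply: is_derive_eq.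
rewrite /normal_fun/= subr0 /GRing.scale/=.
rewrite [- (s ^+ 2 *+ 2)^-1 * x ^+ 2](_ : _ = - x ^+ 2 / (s ^+ 2 *+ 2)); last first.
  by rewrite mulNr [RHS]mulNr mulrC.
by rewrite -[_ *+ 2]mulr_natl; field.
Qed.

Lemma continuous_cos_mul a : continuous (fun x => cos (a * x)).
Proof.
move=> x; apply: continuous_comp; last exact: continuous_cos.
by apply: cvgM; [exact: cvg_cst|exact: cvg_id].
Qed.

Lemma continuous_sin_mul a : continuous (fun x => sin (a * x)).
Proof.
move=> x; apply: continuous_comp; last exact: continuous_sin.
by apply: cvgM; [exact: cvg_cst|exact: cvg_id].
Qed.

Lemma cvg_normal_pdf s (u : nat -> R) : s != 0 ->
  (forall n, `|u n| = n%:R) -> normal_pdf 0 s (u n) @[n --> \oo] --> 0.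
Proof.
move=> s0 un; apply/cvgrPdist_le => e e0; near=> n.
rewrite sub0r normrN ger0_norm ?normal_pdf_ge0//.
have n0 : (0 < n)%N by near: n; exact: nbhs_infty_gt.
rewrite -(@ler_pM2l _ n%:R) ?ltr0n// -[in leLHS]un.
apply: le_trans (abs_normal_pdf_ub _ s0) _.
apply: (@le_trans _ _ (Num.sqrt 2 * `|s| * normal_peak (Num.sqrt 2 * s))).
  rewrite ler_wpM2l ?mulr_ge0 ?sqrtr_ge0//.
  by rewrite normal_pdf_ub// mulf_neq0// gt_eqF// sqrtr_gt0.
rewrite -ler_pdivrMr//; near: n; exact: nbhs_infty_ger.
Unshelve. all: end_near. Qed.

(** The cosine transform of the normal density as a function of the frequency [a], and minus its
    derivative. *)
Let Fcos s a := \int[mu]_x (cos (a * x) * normal_pdf 0 s x).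
Let Fsin s a := \int[mu]_x (x * sin (a * x) * normal_pdf 0 s x).

Let m_pdf s : measurable_fun setT (normal_pdf 0 s).
Proof. exact: measurable_normal_pdf. Qed.

Let m_cos a : measurable_fun setT (fun x => cos (a * x)).
Proof. by apply: continuous_measurable_fun; exact: continuous_cos_mul. Qed.

Let m_sin a : measurable_fun setT (fun x => sin (a * x)).
Proof. by apply: continuous_measurable_fun; exact: continuous_sin_mul. Qed.

Let int_cos s a : s != 0 ->
  mu.-integrable setT (EFin \o (fun x => cos (a * x) * normal_pdf 0 s x)).
Proof.
move=> s0; apply: (@integrable_pdf_bounded s _ 1) => //; first exact: measurable_funM.
move=> x; rewrite normrM (ger0_norm (normal_pdf_ge0 _ _ _)).
by rewrite ler_wpM2r ?normal_pdf_ge0// cos_max.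
Qed.

Let norm_xsin_pdf s a x : s != 0 -> `|x * sin (a * x) * normal_pdf 0 s x| <=
  Num.sqrt 2 * `|s| * normal_pdf 0 (Num.sqrt 2 * s) x.
Proof.
move=> s0; apply: le_trans (abs_normal_pdf_ub _ s0).
rewrite !normrM (ger0_norm (normal_pdf_ge0 _ _ _)).
by rewrite ler_wpM2r ?normal_pdf_ge0// ler_piMr// sin_max.
Qed.

Let int_sin s a : s != 0 ->
  mu.-integrable setT (EFin \o (fun x => x * sin (a * x) * normal_pdf 0 s x)).
Proof.
move=> s0; apply: (@integrable_pdf_bounded (Num.sqrt 2 * s) _ (Num.sqrt 2 * `|s|)) => //.
- by rewrite mulf_neq0// gt_eqF// sqrtr_gt0.
- by apply: measurable_funM => //; exact: measurable_funM.
- by move=> x; exact: norm_xsin_pdf.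
Qed.

(** Integration by parts: [f] is the derivative of [sin (a x)] times the density, so its integral
    vanishes. This turns the derivative of [Fcos s] into a multiple of [Fcos s]. *)
Let Fsin_cos s a : s != 0 -> Fsin s a = s ^+ 2 * a * Fcos s a.
Proof.
move=> s0.
pose f x := a * (cos (a * x) * normal_pdf 0 s x) -
  (s ^+ 2)^-1 * (x * sin (a * x) * normal_pdf 0 s x).
have intf : mu.-integrable setT (EFin \o f).
  rewrite /f /comp; under eq_fun do rewrite EFinB.
  apply: integrableB => //; under eq_fun do rewrite EFinM.
    by apply: integrableZl => //; exact: int_cos.
  by apply: integrableZl => //; exact: int_sin.
have : \int[mu]_x f x = 0.
  apply: (@integral_derivative_eq0 (fun x => sin (a * x) * normal_pdf 0 s x)) => //.
  - have c1 := @continuous_normal_pdf R 0 s s0.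
    have c2 := @continuous_cos_mul a; have c3 := @continuous_sin_mul a.
    move=> x; apply: cvgB; apply: cvgM; try exact: cvg_cst.
      by apply: cvgM; [exact: c2|exact: c1].
    by apply: cvgM; [apply: cvgM; [exact: cvg_id|exact: c3]|exact: c1].
  - move=> x; have h := is_derive_normal_pdf x s0.
    have g : is_derive x 1 (fun y : R => sin (a * y)) (a * cos (a * x)).
      rewrite (_ : (fun y => _) = sin \o (fun y : R => a *: y)) //.
      apply: is_derive_eq; rewrite /GRing.scale/= ?mulr1.
      by rewrite /= mulrC.
    rewrite (_ : (fun x => _) = (fun y => sin (a * y)) * normal_pdf 0 s)//.
    apply: is_derive_eq; rewrite /f /GRing.scale/=.
    by field.
  - apply/norm_cvg0P; apply: squeeze_cvgr (cvg_cst 0) (@cvg_normal_pdf s (fun n => n%:R) s0 _).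
    + near=> n; rewrite normr_ge0/= normrM (ger0_norm (normal_pdf_ge0 _ _ _)).
      by rewrite ler_piMl ?normal_pdf_ge0// sin_max.
    + by move=> n; rewrite ger0_norm.
  - apply/norm_cvg0P; apply: squeeze_cvgr (cvg_cst 0) (@cvg_normal_pdf s (fun n => - n%:R) s0 _).
    + near=> n; rewrite normr_ge0/= normrM (ger0_norm (normal_pdf_ge0 _ _ _)).
      by rewrite ler_piMl ?normal_pdf_ge0// sin_max.
    + by move=> n; rewrite normrN ger0_norm.
rewrite /f RintegralB//; last 2 first.
- by rewrite /comp; under eq_fun do rewrite EFinM; apply: integrableZl => //; exact: int_cos.
- by rewrite /comp; under eq_fun do rewrite EFinM; apply: integrableZl => //; exact: int_sin.
rewrite !RintegralZl//; [|exact: int_sin|exact: int_cos].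
rewrite -/(Fcos s a) -/(Fsin s a) => /eqP; rewrite subr_eq0 => /eqP h.
by rewrite -mulrA h mulVKf// expf_neq0.
Unshelve. all: end_near. Qed.

Let is_derive_Fcos s a : s != 0 -> is_derive a 1 (Fcos s) (- (s ^+ 2 * a * Fcos s a)).
Proof.
move=> s0.
pose f (a x : R) := cos (a * x) * normal_pdf 0 s x.
have df (b x : R) : is_derive b 1 (f ^~ x) (- (x * sin (b * x) * normal_pdf 0 s x)).
  rewrite (_ : f ^~ x = normal_pdf 0 s x *: (cos \o (fun y : R => x *: y))); last first.
    by apply/funext => y; rewrite /f /GRing.scale/= mulrC [y * x]mulrC.
  by apply: is_derive_eq; rewrite /GRing.scale/= mulr1 [x * b]mulrC; ring.
have aI : `](a - 1), (a + 1)[%classic a.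
  by rewrite /= in_itv/=; apply/andP; split; lra.
have dle (x y : R) : `](a - 1), (a + 1)[%classic x -> setT y -> derivable (f ^~ y) x 1.
  by move=> _ _; have [] := df x y.
have d1 (x y : R) : partial1of2 f x y = - (y * sin (x * y) * normal_pdf 0 s y).
  by rewrite partial1of2E; have [_ ->] := df x y.
have G0 x : 0 <= Num.sqrt 2 * `|s| * normal_pdf 0 (Num.sqrt 2 * s) x.
  by rewrite mulr_ge0 ?normal_pdf_ge0// mulr_ge0 ?sqrtr_ge0.
have iG : mu.-integrable setT (EFin \o (fun x => Num.sqrt 2 * `|s| * normal_pdf 0 (Num.sqrt 2 * s) x)).
  apply: (@integrable_pdf_bounded (Num.sqrt 2 * s) _ (Num.sqrt 2 * `|s|)) => //.
  - by rewrite mulf_neq0// gt_eqF// sqrtr_gt0.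
  - by apply: measurable_funM => //; exact: measurable_normal_pdf.
  - by move=> x; rewrite ger0_norm.
have ub (x y : R) : `](a - 1), (a + 1)[%classic x -> setT y -> `|partial1of2 f x y| <= Num.sqrt 2 * `|s| * normal_pdf 0 (Num.sqrt 2 * s) y.
  by move=> _ _; rewrite d1 normrN; exact: norm_xsin_pdf.
have if_ (x : R) : `](a - 1), (a + 1)[%classic x -> mu.-integrable setT (EFin \o f x).
  by move=> _; exact: int_cos.
apply: DeriveDef.
  exact: (derivable_under_integral measurableT aI if_ dle G0 iG ub).
rewrite -derive1E.
rewrite (differentiation_under_integral measurableT aI if_ dle G0 iG ub).
under eq_Rintegral do rewrite d1 -mulN1r.
rewrite RintegralZl//; last exact: int_sin.
by rewrite -/(Fsin s a) Fsin_cos// mulN1r.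
Qed.

Lemma integral_cos_normal_pdf s a : s != 0 ->
  \int[mu]_x (cos (a * x) * normal_pdf 0 s x) = expR (- (s ^+ 2 * a ^+ 2 / 2)).
Proof.
move=> s0; rewrite -/(Fcos s a).
(* [Fcos s] solves [F' = - s^2 a F]; multiplied by the reciprocal of the expected solution it is
   constant, and its value at [0] is the total mass. *)
pose G := Fcos s * (expR \o (fun y : R => (s ^+ 2 / 2) *: y ^+ 2)).
have dG x : is_derive x 1 G 0.
  have := is_derive_Fcos x s0 => h.
  by apply: is_derive_eq; rewrite /GRing.scale/=; field.
have := is_derive_0_is_cst a 0 dG.
rewrite /G fctE/= expr0n/= scaler0 expR0 mulr1 => h.
have F0 : Fcos s 0 = 1.
  rewrite /Fcos; under eq_Rintegral do rewrite mul0r cos0 mul1r.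
  by rewrite /Rintegral integral_normal_pdf.
rewrite {}F0 in h.
have -> : s ^+ 2 * a ^+ 2 / 2 = (s ^+ 2 / 2) *: a ^+ 2 by rewrite /GRing.scale/=; field.
have e0 : expR ((s ^+ 2 / 2) *: a ^+ 2) != 0 by rewrite gt_eqF ?expR_gt0.
by apply: (mulIf e0); rewrite [LHS]h expRN mulVf.
Qed.

End GaussianChar.

(** * The Green function *)

Section Green.
Context {R : realType} {d : nat}.
Implicit Types (x y z : zpoint d) (f g : zpoint d -> R).

Definition nbrs x : seq (zpoint d) :=
  flatten [seq [:: shift x i 1; shift x i (-1)] | i <- enum 'I_d].

Definition avg f x : R := (d.*2)%:R^-1 * \sum_(y <- nbrs x) f y.

Lemma sum_nbrs f x :
  \sum_(y <- nbrs x) f y = \sum_(i < d) (f (shift x i 1) + f (shift x i (-1))).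
Proof.
rewrite /nbrs big_flatten/= big_map big_enum/=; apply: eq_bigr => i _.
by rewrite !big_cons big_nil addr0.
Qed.

Lemma avgE f x :
  avg f x = (d.*2)%:R^-1 * \sum_(i < d) (f (shift x i 1) + f (shift x i (-1))).
Proof. by rewrite /avg sum_nbrs. Qed.

Lemma srw_pS n x y : srw_p R n.+1 x y = avg (srw_p R n ^~ y) x.
Proof. by rewrite avgE. Qed.

Lemma avg_ge f g x : (forall y, f y <= g y) -> avg f x <= avg g x.
Proof. by move=> fg; rewrite ler_wpM2l ?invr_ge0// ler_sum. Qed.

Lemma avg_sum n (F : nat -> zpoint d -> R) x :
  avg (fun y => \sum_(0 <= k < n) F k y) x = \sum_(0 <= k < n) avg (F k) x.
Proof. by rewrite /avg exchange_big mulr_sumr. Qed.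

Lemma shiftD x z i s : shift (x + z) i s = shift x i s + z.
Proof. by apply/ffunP => j; rewrite !ffunE; case: eqP => //; rewrite addrAC. Qed.

Lemma shiftN x i s : shift (- x) i s = - shift x i (- s).
Proof. by apply/ffunP => j; rewrite !ffunE; case: eqP => //; rewrite opprD opprK. Qed.

Lemma srw_p_ge0 n x y : 0 <= srw_p R n x y.
Proof.
elim: n x => [|n IH] x; first by rewrite ler0n.
by rewrite srw_pS mulr_ge0 ?invr_ge0// sumr_ge0.
Qed.

Lemma srw_pD n x y z : srw_p R n (x + z) (y + z) = srw_p R n x y.
Proof.
elim: n x => [|n IH] x; first by rewrite /= (inj_eq (addIr z)).
by rewrite !srw_pS !avgE; congr (_ * _); apply: eq_bigr => i _; rewrite !shiftD !IH.
Qed.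

Lemma srw_pN n x y : srw_p R n (- x) (- y) = srw_p R n x y.
Proof.
elim: n x => [|n IH] x; first by rewrite /= eqr_opp.
rewrite !srw_pS !avgE; congr (_ * _); apply: eq_bigr => i _.
by rewrite !shiftN !IH opprK addrC.
Qed.

(** Reflection through the origin followed by translation by [x + y] exchanges [x] and [y]. *)
Lemma srw_p_sym n x y : srw_p R n x y = srw_p R n y x.
Proof.
by rewrite -srw_pN -(srw_pD n (- x) (- y) (x + y)) addrA addNr add0r addrCA addNr addr0.
Qed.

Lemma srw_p0 n x y : srw_p R n x y = srw_p R n (x - y) 0.
Proof. by rewrite -(srw_pD n x y (- y)) subrr. Qed.

Definition sqn x : R := \sum_(i < d) ((x i)%:~R) ^+ 2.

Lemma sqn_shift x i s :
  sqn (shift x i s) = sqn x + 2 * (x i)%:~R * s%:~R + s%:~R ^+ 2.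
Proof.
rewrite /sqn (bigD1 i)//= [in RHS](bigD1 i)//= ffunE eqxx.
under eq_bigr => j ji do rewrite ffunE (negbTE ji).
by rewrite rmorphD/=; ring.
Qed.

Lemma sqn_ge0 x : 0 <= sqn x.
Proof. by rewrite sumr_ge0// => i _; rewrite sqr_ge0. Qed.

Lemma sqn_ge x i : ((x i)%:~R) ^+ 2 <= sqn x.
Proof. by rewrite /sqn (bigD1 i)//= lerDl sumr_ge0// => j _; rewrite sqr_ge0. Qed.

Lemma sqn_nat x : exists n : nat, sqn x = n%:R.
Proof.
exists (\sum_(i < d) `|x i| ^ 2)%N; rewrite natr_sum; apply: eq_bigr => i _.
by rewrite natrX natr_absz intr_norm real_normK// num_real.
Qed.

Lemma sqn_eq0 x : (sqn x == 0) = (x == 0).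
Proof.
apply/eqP/eqP => [h|->]; last by rewrite /sqn big1// => i _; rewrite ffunE expr0n.
apply/ffunP => i; rewrite ffunE; have := sqn_ge x i; rewrite h => h2.
have : ((x i)%:~R : R) ^+ 2 == 0 by rewrite eq_le h2 sqr_ge0.
by rewrite sqrf_eq0 intr_eq0 => /eqP.
Qed.

(** Integrality of the coordinates excludes [1 < (x i)^2 < 4], where the inequality can fail:
    formally with [(x i)^2 = 2], [sqn x = 2] and [s = 0]. *)
Lemma sqn_int x i (s : R) : 0 <= s ->
  2 <= sqn x -> (sqn x + 1 + s) ^+ 2 / 5 <= (sqn x + 1 + s) ^+ 2 - 4 * ((x i)%:~R) ^+ 2.
Proof.
move=> s0; have := sqn_ge x i; set r := sqn x => xr x2.
set a := (x i)%:~R in xr *.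
have [a1|a2] : a ^+ 2 <= 1 \/ 4 <= a ^+ 2.
  rewrite /a -[(x i)%:~R ^+ 2]real_normK ?num_real// -intr_norm -natr_absz.
  case: `|x i|%N => [|[|n]]; [left|left|right]; rewrite ?expr0n ?expr1n ?ler01//.
  by rewrite -natrX ler_nat; nia.
- have h : 0 <= (r + 1 + s - 3) * (r + 1 + s + 3) by apply: mulr_ge0; lra.
  by nra.
- have h : 0 <= (r + 1 + s - (a ^+ 2 + 1)) * (r + 1 + s + (a ^+ 2 + 1)).
    by apply: mulr_ge0; lra.
  by nra.
Qed.

(* Lyapunov function for transience: with [s = 2 / d], [lyap - avg lyap] dominates the indicator
   of the origin, so [lyap] dominates the Green function, and its maximum is [1 + 2 / d]. *)
Definition lyap (s : R) x : R := s * (1 + s) / (sqn x + s).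

Lemma avg_lyap (s := 2 / d%:R) x : (20 <= d)%N ->
  (x == 0)%:R + avg (lyap s) x <= lyap s x.
Proof.
move=> d20.
have d0 : (0 < d%:R :> R) by rewrite ltr0n; lia.
have s0 : 0 < s by rewrite divr_gt0.
have sd : s * d%:R = 2 by rewrite /s divfK// gt_eqF.
have d20R : 20 <= d%:R :> R by rewrite (ler_nat R 20).
rewrite avgE -muln2 natrM invfM.
have sc i : lyap s (shift x i 1) + lyap s (shift x i (-1)) =
  s * (1 + s) * (1 / (sqn x + 1 + s + 2 * (x i)%:~R) + 1 / (sqn x + 1 + s - 2 * (x i)%:~R)).
  rewrite /lyap !sqn_shift !rmorph1 rmorphN1 sqrrN expr1n !mulr1 mulrN1.
  rewrite [RHS]mulrDr !mul1r; congr (_ + _); congr (_ * _^-1); ring.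
under eq_bigr do rewrite sc.
rewrite -mulr_sumr.
(* The factor [s * (1 + s)] normalizes [lyap] so that equality holds at the origin. *)
have [/eqP x0|x0] := boolP (x == 0).
  rewrite /lyap; have -> : sqn x = 0 by apply/eqP; rewrite sqn_eq0 x0.
  have xi i : (x i)%:~R = 0 :> R by rewrite x0 ffunE.
  under eq_bigr do rewrite xi mulr0 subr0 addr0 add0r.
  rewrite sumr_const card_ord -(mulr_natr (_ + _)) /= le_eqVlt; apply/orP; left; apply/eqP.
  have s1 : (1 + s == 0) = false by rewrite gt_eqF// addr_gt0.
  by field; rewrite s1 !gt_eqF.
rewrite add0r.
have x1 : 1 <= sqn x.
  have := x0; rewrite -sqn_eq0; case: (sqn_nat x) => -[|n ->]; first by move=> ->; rewrite eqxx.
  by rewrite (ler_nat R 1).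
have den i : 0 < (sqn x + 1 + s) ^+ 2 - 4 * ((x i)%:~R) ^+ 2.
  by have := sqn_ge x i; nra.
have sc2 i : 1 / (sqn x + 1 + s + 2 * (x i)%:~R) + 1 / (sqn x + 1 + s - 2 * (x i)%:~R) =
  2 / (sqn x + 1 + s) + 8 / (sqn x + 1 + s) * (((x i)%:~R) ^+ 2 / ((sqn x + 1 + s) ^+ 2 - 4 * ((x i)%:~R) ^+ 2)).
  have := den i; set A := sqn x + 1 + s; set a := (x i)%:~R => h.
  have fac : A ^+ 2 - 4 * a ^+ 2 = (A + 2 * a) * (A - 2 * a) by ring.
  have [h1 h2] : A + 2 * a != 0 /\ A - 2 * a != 0.
    by move: h; rewrite fac => /lt0r_neq0; rewrite mulf_eq0 negb_or => /andP.
  have A0 : A != 0 by rewrite gt_eqF// /A; lra.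
  by rewrite fac; field; rewrite A0 h1 h2.
under eq_bigr do rewrite sc2.
rewrite big_split/= sumr_const card_ord -(mulr_natr (2 / _)) -mulr_sumr.
set S := \sum_(i < d) _.
(* Once [2 / (sqn x + 1 + s)] is split off in each direction, this is what the claim reduces to. At
   [sqn x = 1] the sum [S] is of order [1 / s], which forces [s] to be at least of order [1 / d];
   for [sqn x >= 2] the left side is at most 20, whence the requirement on [d]. *)
have S0 : 4 * S * (sqn x + s) <= d%:R.
  have [xe1|xe2] : sqn x = 1 \/ 2 <= sqn x.
    case: (sqn_nat x) x1 => -[|[|n]] ->; [by rewrite ler10|by left|right].
    by rewrite (ler_nat R 2).
  - have Si : S <= (s * (4 + s))^-1.
      have -> : (s * (4 + s))^-1 = \sum_(i < d) ((x i)%:~R ^+ 2 * (s * (4 + s))^-1).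
        by rewrite -mulr_suml -/(sqn x) xe1 mul1r.
      apply: ler_sum => i _; rewrite ler_wpM2l ?sqr_ge0//.
      rewrite lef_pV2 ?posrE//; last by nra.
      by have := sqn_ge x i; rewrite xe1; nra.
    have : 4 * S * (sqn x + s) <= 4 * (s * (4 + s))^-1 * (1 + s).
      by rewrite xe1 ler_wpM2r//; lra.
    move/le_trans; apply.
    rewrite mulrAC ler_pdivrMr; last by nra.
    have s1 : s <= 1/10 by rewrite /s ler_pdivrMr//; lra.
    nra.
  - set A := sqn x + 1 + s.
    have Si : S <= 5 * sqn x / A ^+ 2.
      have -> : 5 * sqn x / A ^+ 2 = \sum_(i < d) ((x i)%:~R ^+ 2 * (5 / A ^+ 2)).
        by rewrite -mulr_suml -/(sqn x); ring.
      apply: ler_sum => i _; rewrite ler_wpM2l ?sqr_ge0//.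
      rewrite -[5 / _]invrK invfM invrK lef_pV2 ?posrE//.
      + by have := @sqn_int x i s (ltW s0) xe2; rewrite -/A mulrC.
      + by rewrite mulr_gt0 ?invr_gt0 ?exprn_gt0// /A; lra.
    have A0 : 0 < A by rewrite /A; lra.
    have : 4 * S * (sqn x + s) <= 4 * (5 * sqn x / A ^+ 2) * (sqn x + s).
      by rewrite ler_wpM2r ?ler_wpM2l//; lra.
    move/le_trans; apply.
    rewrite mulrA mulrAC ler_pdivrMr ?exprn_gt0//.
    apply: (@le_trans _ _ (20 * A ^+ 2)); last by rewrite ler_wpM2r ?sqr_ge0.
    by rewrite /A; nra.
rewrite /lyap -[leRHS]mulr1 -mulrA mulrCA [leRHS]mulrAC -mulrA.
rewrite ler_wpM2l//; first by nra.
have r0 : 0 < sqn x + s by lra.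
have A0 : 0 < sqn x + 1 + s by lra.
rewrite -subr_ge0.
have -> : 1 * (sqn x + s)^-1 - d%:R^-1 * 2^-1 * (2 * ((sqn x + 1 + s)^-1 * d%:R) + 8 / (sqn x + 1 + s) * S)
  = (d%:R - 4 * S * (sqn x + s)) / (d%:R * (sqn x + s) * (sqn x + 1 + s)).
  by field; rewrite !gt_eqF.
by rewrite divr_ge0 ?subr_ge0// !mulr_ge0// ltW.
Qed.

Hypothesis d20 : (20 <= d)%N.

(** Conditioning on the first step writes the sum of [n + 1] terms as an indicator plus an average
    of sums of [n] terms, and [avg_lyap] absorbs exactly that. *)
Lemma sum_srw_p_le n x y :
  \sum_(0 <= k < n) srw_p R k x y <= lyap (2 / d%:R) (x - y).
Proof.
under eq_bigr do rewrite srw_p0.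
elim: n (x - y) => {x y} [|n IH] x.
  have s0 : 0 <= 2 / d%:R :> R by rewrite divr_ge0.
  by rewrite big_nil /lyap; apply: divr_ge0; rewrite ?mulr_ge0 ?addr_ge0 ?sqn_ge0.
apply: le_trans (avg_lyap x d20); rewrite big_nat_recl//; apply: lerD => //.
by under eq_bigr do rewrite srw_pS; rewrite -avg_sum avg_ge.
Qed.

Lemma lyap_le x : lyap (2 / d%:R) x <= 1 + 2 / d%:R.
Proof.
have d0 : (0 < d%:R :> R) by rewrite ltr0n; lia.
have s0 : 0 < 2 / d%:R :> R by rewrite divr_gt0.
rewrite /lyap; move: (2 / _) s0 => s s0.
have := sqn_ge0 x; move: (sqn x) => r r0.
by rewrite ler_pdivrMr; [nra|lra].
Qed.

(** [green] applies [fine] to an extended sum, and [fine] sends infinity to [0]. The bound by [lyap]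
    shows that the sum is finite, so [green] is the true limit. *)
Lemma cvg_green x y : series (fun n => srw_p R n x y) n @[n --> \oo] --> green R x y.
Proof.
have nd : nondecreasing_seq (series (fun n => srw_p R n x y)).
  apply/nondecreasing_seqP => n.
  by rewrite /series/= big_nat_recr//= lerDl srw_p_ge0.
have ub n : series (fun n => srw_p R n x y) n <= 1 + 2 / d%:R.
  by apply: le_trans (sum_srw_p_le _ _ _) (lyap_le _).
have hub : has_ubound (range (series (fun n => srw_p R n x y))).
  by exists (1 + 2 / d%:R) => _ [n _ <-]; exact: ub.
have cv := nondecreasing_is_cvgn nd hub.
rewrite /green.
have -> : (\sum_(n <oo) (srw_p R n x y)%:E)%E = (limn (series (fun n => srw_p R n x y)))%:E.
  rewrite -EFin_lim//; congr (limn _); apply/funext => n.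
  by rewrite /series/= sumEFin.
exact: cv.
Qed.

Lemma green_le x y : green R x y <= 1 + 2 / d%:R.
Proof.
rewrite -(cvg_lim (@Rhausdorff R) (@cvg_green x y)).
apply: limr_le; first by apply/cvg_ex; eexists; exact: cvg_green.
by apply: nearW => n; apply: le_trans (sum_srw_p_le _ _ _) (lyap_le _).
Qed.

Lemma green_sym x y : green R x y = green R y x.
Proof.
rewrite /green; congr fine; congr (limn _); apply/funext => n.
by apply: eq_bigr => k _; rewrite srw_p_sym.
Qed.

Lemma green_diag x : green R x x = green R (origin d) (origin d).
Proof.
rewrite /green; congr fine; congr (limn _); apply/funext => n.
by apply: eq_bigr => k _; rewrite srw_p0 [in RHS]srw_p0 !subrr.
Qed.

Lemma greenE x y : green R x y = (x == y)%:R + avg (fun z => green R z y) x.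
Proof.
have h1 : series (fun n => srw_p R n x y) n.+1 @[n --> \oo] --> green R x y.
  by rewrite (cvg_shiftS (series (fun n => srw_p R n x y))); exact: cvg_green.
have h2 : (x == y)%:R + avg (fun z => series (fun n => srw_p R n z y) n) x @[n --> \oo]
    --> (x == y)%:R + avg (fun z => green R z y) x.
  apply: cvgD; first exact: cvg_cst.
  apply: cvgM; first exact: cvg_cst.
  elim: (nbrs x) => [|z l IH].
    by under eq_fun do rewrite big_nil; rewrite big_nil; exact: cvg_cst.
  by under eq_fun do rewrite big_cons; rewrite big_cons; apply: cvgD; [exact: cvg_green|exact: IH].
have e : (fun n => series (fun n => srw_p R n x y) n.+1) =
    (fun n => (x == y)%:R + avg (fun z => series (fun n => srw_p R n z y) n) x).
  apply/funext => n; rewrite /series/= big_nat_recl//; congr (_ + _).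
  by rewrite avg_sum; apply: eq_bigr => k _; rewrite srw_pS.
by rewrite -e in h2; exact: (cvg_unique _ h1 h2).
Qed.

End Green.

(** * Linear forms in the field and their covariances *)

Section LinearForms.
Context {R : realType} {d : nat}.
Implicit Types (x y z : zpoint d) (l : seq (R * zpoint d)).

Definition lform (f : zpoint d -> R) l : R := \sum_(p <- l) p.1 * f p.2.

Definition gform l1 l2 : R :=
  \sum_(p <- l1) \sum_(q <- l2) p.1 * q.1 * green R p.2 q.2.

(** [is_GFF] attaches one coefficient to each point, while a form may list a point several times
    with different coefficients. Collecting coefficients reconciles the two. *)
Lemma lform_undup f l :
  \sum_(z <- undup (map snd l)) (\sum_(p <- l | p.2 == z) p.1) * f z = lform f l.
Proof.
under eq_bigr do rewrite mulr_suml.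
rewrite (exchange_big_dep predT)//= /lform big_seq_cond [RHS]big_seq_cond.
apply: eq_bigr => p; rewrite andbT => pl.
under eq_bigl => z do rewrite eq_sym.
by rewrite -big_filter (filter_pred1_uniq (undup_uniq _)) ?big_seq1// mem_undup map_f.
Qed.

Lemma gff_lform (dT : measure_display) (T : measurableType dT) (P : probability T R)
  (phi : zpoint d -> {RV P >-> R}) l (A : set R) : is_GFF phi -> measurable A ->
  P ((fun w => lform (fun x => phi x w) l) @^-1` A) = gauss_law (gform l l) A.
Proof.
move=> gff mA.
have := gff (undup (map snd l)) (fun z => \sum_(p <- l | p.2 == z) p.1) A mA.
under eq_fun do rewrite (lform_undup (fun x => phi x _)).
move=> ->; congr gauss_law.
transitivity (lform (fun x => lform (green R x) l) l).
  rewrite -lform_undup; apply: eq_bigr => z _.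
  rewrite -lform_undup mulr_sumr; apply: eq_bigr => z' _.
  by rewrite !mulrA.
rewrite /lform /gform; apply: eq_bigr => p _; rewrite mulr_sumr.
by apply: eq_bigr => q _; rewrite !mulrA.
Qed.

Lemma gformE l1 l2 : gform l1 l2 = lform (fun x => lform (green R x) l2) l1.
Proof.
rewrite /lform /gform; apply: eq_bigr => p _; rewrite mulr_sumr.
by apply: eq_bigr => q _; rewrite !mulrA.
Qed.

(* Linear forms in the field: [avgl x] stands for the average over the neighbours of [x], and
   [innov x] for [phi x] minus that average. *)
Definition avgl x : seq (R * zpoint d) := [seq ((d.*2)%:R^-1, y) | y <- nbrs x].

Definition innov x : seq (R * zpoint d) := (1, x) :: [seq (- p.1, p.2) | p <- avgl x].

Lemma lform_avgl f x : lform f (avgl x) = avg f x.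
Proof. by rewrite /lform big_map /avg mulr_sumr. Qed.

Lemma lform_innov f x : lform f (innov x) = f x - avg f x.
Proof.
rewrite -lform_avgl /lform big_cons mul1r big_map -sumrN; congr (_ + _).
by apply: eq_bigr => p _; rewrite mulNr.
Qed.

(** A linear combination of forms is again a form, so the hypothesis on single combinations also
    covers families of forms. *)
Definition combine_forms n (a : 'I_n -> R) (L : 'I_n -> seq (R * zpoint d)) :=
  flatten [seq [seq (a i * p.1, p.2) | p <- L i] | i <- enum 'I_n].

Lemma lform_combine f n (a : 'I_n -> R) L :
  lform f (combine_forms a L) = \sum_(i < n) a i * lform f (L i).
Proof.
rewrite /lform /combine_forms big_flatten/= big_map big_enum/=; apply: eq_bigr => i _.
by rewrite big_map mulr_sumr; apply: eq_bigr => p _; rewrite mulrA.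
Qed.

Lemma lform_sum f n (F : 'I_n -> zpoint d -> R) l :
  (forall x, f x = \sum_(i < n) F i x) -> lform f l = \sum_(i < n) lform (F i) l.
Proof.
move=> fE; rewrite /lform exchange_big/=; apply: eq_bigr => p _.
by rewrite fE mulr_sumr.
Qed.

Lemma lformZ a f l : lform (fun x => a * f x) l = a * lform f l.
Proof. by rewrite /lform mulr_sumr; apply: eq_bigr => p _; rewrite mulrCA. Qed.

Lemma gform_combine n (a : 'I_n -> R) L :
  gform (combine_forms a L) (combine_forms a L) =
  \sum_(i < n) \sum_(j < n) a i * a j * gform (L i) (L j).
Proof.
rewrite gformE lform_combine; apply: eq_bigr => i _.
rewrite (lform_sum (F := fun j x => a j * lform (green R x) (L j))); last first.
  by move=> x; rewrite lform_combine.
rewrite mulr_sumr; apply: eq_bigr => j _.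
by rewrite lformZ mulrA -gformE.
Qed.

Hypothesis d20 : (20 <= d)%N.

Lemma lform_green_innov x y : lform (green R x) (innov y) = (x == y)%:R.
Proof.
rewrite lform_innov; have -> : green R x = (fun z => green R z x).
  by apply/funext => z; rewrite green_sym.
by rewrite greenE// addrK eq_sym.
Qed.

Lemma shift_neq x i s : s != 0 -> (shift x i s == x) = false.
Proof.
move=> s0; apply/eqP => /ffunP/(_ i); rewrite ffunE eqxx => /eqP.
by rewrite -subr_eq0 addrAC subrr add0r (negbTE s0).
Qed.

(* [(I - P) G = I], so the innovations have covariance [I - P]: they are exactly independent
   off the nearest-neighbour graph. *)
Lemma gform_innov x y : (forall i s, s != 0 -> shift x i s != y) ->
  gform (innov x) (innov y) = (x == y)%:R.
Proof.
move=> xy; rewrite gformE.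
have -> : (fun z => lform (green R z) (innov y)) = (fun z => (z == y)%:R).
  by apply/funext => z; rewrite lform_green_innov.
rewrite lform_innov avgE big1 ?mulr0 ?subr0// => i _.
by rewrite !(negbTE (xy _ _ _)) ?addr0.
Qed.

(** From [G = I + P G] one gets [P G P = G - I - P], and [P] vanishes on the diagonal. *)
Lemma gform_avgl x : gform (avgl x) (avgl x) = green R (origin d) (origin d) - 1.
Proof.
have avg_green z : avg (green R z) x = green R z x - (z == x)%:R.
  have -> : green R z = (fun z' => green R z' z) by apply/funext => z'; rewrite green_sym.
  by rewrite eq_sym greenE// addrAC subrr add0r.
rewrite gformE lform_avgl.
under eq_fun do rewrite lform_avgl avg_green.
rewrite /avg sumrB mulrBr -/(avg (fun z => green R z x) x).
rewrite -(green_diag x) greenE// eqxx addrAC subrr add0r.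
rewrite sum_nbrs big1 ?mulr0 ?subr0// => i _.
by rewrite !shift_neq// addr0.
Qed.

End LinearForms.

(** * Expectations of bounded functions of Gaussian variables *)

Section Bounded.
Context {R : realType} (dT : measure_display) (T : measurableType dT) (P : probability T R).
Implicit Types f g : T -> R.

(** A class stable under sums and products on which integrability is automatic. *)
Definition bmeas g := measurable_fun setT g /\ exists M, forall w, `|g w| <= M.

Lemma bmeas_integrable g : bmeas g -> P.-integrable setT (EFin \o g).
Proof.
move=> [mg [M gM]]; apply: measurable_bounded_integrable => //.
  by rewrite (le_lt_trans (probability_le1 P measurableT)) ?ltry.
exists M; split; first by rewrite num_real.
by move=> x Mx w _ /=; rewrite (le_trans (gM w))// ltW.
Qed.

Lemma bmeas_cst c : bmeas (fun=> c).
Proof. by split => //; exists `|c|. Qed.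

Lemma bmeasD f g : bmeas f -> bmeas g -> bmeas (fun w => f w + g w).
Proof.
move=> [mf [M fM]] [mg [N gN]]; split; first exact: measurable_funD.
by exists (M + N) => w; rewrite (le_trans (ler_normD _ _))// lerD.
Qed.

Lemma bmeasM f g : bmeas f -> bmeas g -> bmeas (fun w => f w * g w).
Proof.
move=> [mf [M fM]] [mg [N gN]]; split; first exact: measurable_funM.
by exists (M * N) => w; rewrite normrM ler_pM.
Qed.

Lemma bmeas_sum (I : Type) (s : seq I) (F : I -> T -> R) : (forall i, bmeas (F i)) ->
  bmeas (fun w => \sum_(i <- s) F i w).
Proof.
move=> mF; elim: s => [|i s IH].
  by under eq_fun do rewrite big_nil; exact: bmeas_cst.
by under eq_fun do rewrite big_cons; exact: bmeasD.
Qed.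

Lemma bmeas_prod (I : Type) (s : seq I) (F : I -> T -> R) : (forall i, bmeas (F i)) ->
  bmeas (fun w => \prod_(i <- s) F i w).
Proof.
move=> mF; elim: s => [|i s IH].
  by under eq_fun do rewrite big_nil; exact: bmeas_cst.
by under eq_fun do rewrite big_cons; exact: bmeasM.
Qed.

Lemma bmeas_cos f : measurable_fun setT f -> bmeas (fun w => cos (f w)).
Proof.
move=> mf; split; last by exists 1 => w; exact: cos_max.
apply: (measurableT_comp _ mf); apply: continuous_measurable_fun; exact: continuous_cos.
Qed.

Lemma RintegralD_bmeas f g : bmeas f -> bmeas g ->
  \int[P]_w (f w + g w) = \int[P]_w f w + \int[P]_w g w.
Proof. by move=> mf mg; rewrite RintegralD//; exact: bmeas_integrable. Qed.

Lemma RintegralZ_bmeas c f : bmeas f -> \int[P]_w (c * f w) = c * \int[P]_w f w.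
Proof. by move=> mf; rewrite RintegralZl//; exact: bmeas_integrable. Qed.

Lemma Rintegral_sum_bmeas (I : Type) (s : seq I) (F : I -> T -> R) : (forall i, bmeas (F i)) ->
  \int[P]_w (\sum_(i <- s) F i w) = \sum_(i <- s) \int[P]_w F i w.
Proof.
move=> mF; elim: s => [|i s IH].
  under eq_Rintegral do rewrite big_nil.
  by rewrite big_nil Rintegral_cst// mul0r.
under eq_Rintegral do rewrite big_cons.
by rewrite big_cons RintegralD_bmeas ?IH//; exact: bmeas_sum.
Qed.

Lemma le_Rintegral_bmeas f g : bmeas f -> bmeas g -> (forall w, f w <= g w) ->
  \int[P]_w f w <= \int[P]_w g w.
Proof. by move=> mf mg fg; apply: le_Rintegral => //; exact: bmeas_integrable. Qed.

Lemma Rintegral_indic (A : set T) : measurable A -> \int[P]_w \1_A w = fine (P A).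
Proof. by move=> mA; rewrite /Rintegral integral_indic// setIT. Qed.

Lemma bmeas_indic (A : set T) : measurable A -> bmeas \1_A.
Proof.
move=> mA; split; first exact: measurable_indic.
by exists 1 => w; rewrite indicE; case: (_ \in _); rewrite ?normr1 ?normr0.
Qed.

Lemma fine_prob_le f (A : set T) c : 0 < c -> measurable A -> bmeas f -> (forall w, 0 <= f w) ->
  (forall w, A w -> c <= f w) -> fine (P A) <= c^-1 * \int[P]_w f w.
Proof.
move=> c0 mA mf f0 Af; rewrite -Rintegral_indic// -RintegralZ_bmeas//.
apply: le_Rintegral_bmeas; [exact: bmeas_indic|exact: bmeasM (bmeas_cst _) mf|].
move=> w; rewrite indicE; case: (boolP (w \in A)) => [|_].
  by rewrite inE => /Af cf; rewrite mulrC ler_pdivlMr// mul1r.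
by rewrite mulr_ge0// invr_ge0 ltW.
Qed.

Lemma fine_prob_ge f (A : set T) c : 0 <= c -> measurable A -> bmeas f -> (forall w, 0 <= f w) ->
  (forall w, A w -> c <= f w) -> c * fine (P A) <= \int[P]_w f w.
Proof.
move=> c0 mA mf f0 Af; rewrite -Rintegral_indic// -RintegralZ_bmeas//; last exact: bmeas_indic.
apply: le_Rintegral_bmeas => //; first exact: bmeasM (bmeas_cst _) (bmeas_indic mA).
move=> w; rewrite indicE; case: (boolP (w \in A)) => [|_].
  by rewrite inE => /Af cf; rewrite mulr1.
by rewrite mulr0.
Qed.

Lemma Rintegral_law (Y : T -> R) (m : {measure set (measurableTypeR R) -> \bar R}) (f : R -> R) (M : R) :
  measurable_fun setT Y -> measurable_fun setT f -> (forall x, `|f x| <= M) ->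
  (forall A : set R, measurable A -> P (Y @^-1` A) = m A) ->
  \int[P]_w f (Y w) = \int[m]_x f x.
Proof.
move=> mY mf fM law; rewrite /Rintegral; congr fine.
have intf : P.-integrable setT ((EFin \o f) \o Y).
  apply: (@bmeas_integrable (f \o Y)); split; last by exists M => w; exact: fM.
  exact: measurableT_comp.
have := @integral_pushforward _ _ T (measurableTypeR R) R Y mY P setT (EFin \o f).
rewrite preimage_setT => <- //; last exact/measurable_EFinP.
pose Y' : {mfun T >-> measurableTypeR R} := HB.pack Y (isMeasurableFun.Build _ _ T (measurableTypeR R) Y mY).
have h : (\int[pushforward P Y']_y (EFin \o f) y = \int[m]_y (EFin \o f) y)%E.
  by apply: eq_measure_integral => A mA _; rewrite /= /pushforward law.
exact: h.
Qed.

End Bounded.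

(** * Estimates for centered Gaussian laws *)

Section GaussianLaw.
Context {R : realType} (dT : measure_display) (T : measurableType dT) (P : probability T R).

Definition gaussian_rv (Y : T -> R) (v : R) :=
  measurable_fun setT Y /\
  forall A : set R, measurable A -> P (Y @^-1` A) = gauss_law v A.

Let mcos : measurable_fun [set: R] (@cos R).
Proof. by apply: continuous_measurable_fun; exact: continuous_cos. Qed.

Lemma Rintegral_cos_gaussian Y v : gaussian_rv Y v -> 0 <= v ->
  \int[P]_w cos (Y w) = expR (- (v / 2)).
Proof.
move=> [mY law]; rewrite le_eqVlt => /predU1P[v0|v0].
  rewrite (@Rintegral_law _ _ _ P Y (\d_ (0 : measurableTypeR R)) cos 1)//.
  - rewrite /Rintegral integral_dirac//; last exact/measurable_EFinP.
    by rewrite diracT mul1e/= cos0 -v0 mul0r oppr0 expR0.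
  - by move=> x; exact: cos_max.
  - by move=> A mA; rewrite law// /gauss_law -v0 eqxx.
have s0 : Num.sqrt v != 0 by rewrite gt_eqF// sqrtr_gt0.
rewrite (@Rintegral_law _ _ _ P Y (normal_prob 0 (Num.sqrt v)) cos 1)//; last 2 first.
- by move=> x; exact: cos_max.
- by move=> A mA; rewrite law// /gauss_law gt_eqF.
rewrite /Rintegral integral_normal_prob; last 2 first.
- exact/measurable_EFinP.
- by apply: bmeas_integrable; split=> //; exists 1 => x; exact: cos_max.
under eq_integral => x _ do rewrite -EFinM -[x in cos x]mul1r.
rewrite -[LHS]/(Rintegral _ _ _) integral_cos_normal_pdf// sqr_sqrtr ?ltW//.
by rewrite expr1n mulr1.
Qed.

(* The two laws agree, so the odd part of the phase-shifted cosine integrates to 0. *)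
Lemma Rintegral_cos_shift_gaussian Y v b : gaussian_rv Y v ->
  gaussian_rv (fun w => - Y w) v -> 0 <= v ->
  \int[P]_w cos (Y w + b) = cos b * expR (- (v / 2)).
Proof.
move=> gY gNY v0; have [mY lawY] := gY; have [mNY lawNY] := gNY.
have mb : measurable_fun [set: R] (fun y => cos (y + b)).
  by apply: measurableT_comp => //; exact: measurable_funD.
have e : \int[P]_w cos (Y w + b) = \int[P]_w cos (- Y w + b).
  have [v_eq0|v_neq0] := eqVneq v 0.
    rewrite !(@Rintegral_law _ _ _ P _ (\d_ (0 : measurableTypeR R)) (fun y => cos (y + b)) 1)//.
    - by move=> x; exact: cos_max.
    - by move=> A mA; rewrite lawNY// /gauss_law v_eq0 eqxx.
    - by move=> x; exact: cos_max.
    - by move=> A mA; rewrite lawY// /gauss_law v_eq0 eqxx.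
  rewrite !(@Rintegral_law _ _ _ P _ (normal_prob 0 (Num.sqrt v)) (fun y => cos (y + b)) 1)//.
  - by move=> x; exact: cos_max.
  - by move=> A mA; rewrite lawNY// /gauss_law (negbTE v_neq0).
  - by move=> x; exact: cos_max.
  - by move=> A mA; rewrite lawY// /gauss_law (negbTE v_neq0).
have bc (Z : T -> R) : measurable_fun setT Z -> bmeas (fun w => cos (Z w + b)).
  by move=> mZ; apply: bmeas_cos; exact: measurable_funD.
have : \int[P]_w cos (Y w + b) + \int[P]_w cos (- Y w + b) = 2 * (cos b * expR (- (v / 2))).
  rewrite -RintegralD_bmeas; [|exact: bc|exact: (bc (fun w => - Y w))].
  rewrite -(Rintegral_cos_gaussian gY v0) mulrA -RintegralZ_bmeas; last exact: bmeas_cos.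
  by apply: eq_Rintegral => w _; rewrite !cosD cosN sinN; ring.
by rewrite -e; lra.
Qed.

(** The bound from [normal_pdf_tail_split] increases with the variance, so [V] may replace [v]. The
    degenerate law sits at [0] and puts no mass below [- t]. *)
Lemma gaussian_rv_lt Y v V t : gaussian_rv Y v -> 0 <= v <= V -> 0 < V -> 0 < t ->
  fine (P (Y @^-1` [set y | y < - t])) <= Num.sqrt 2 * expR (- (t ^+ 2 / (4 * V))).
Proof.
move=> [mY law] /andP[v0 vV] V0 t0.
have mA : measurable [set y : R | y < - t].
  by have := measurable_itv `]-oo, (- t)[; rewrite set_itvE.
rewrite law// /gauss_law; case: ifPn => vn0.
  rewrite /= /dirac indicE memNset/= ?mulr_ge0 ?sqrtr_ge0 ?expR_ge0//.
  by apply/negP; rewrite -leNgt oppr_le0 ltW.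
have {}v0 : 0 < v by rewrite lt_neqAle eq_sym vn0.
have s0 : Num.sqrt v != 0 by rewrite gt_eqF// sqrtr_gt0.
have s20 : Num.sqrt 2 * Num.sqrt v != 0 by rewrite mulf_neq0// gt_eqF// sqrtr_gt0.
set c := Num.sqrt 2 * expR (- (t ^+ 2 / (4 * v))).
have c0 : 0 <= c by rewrite mulr_ge0 ?sqrtr_ge0 ?expR_ge0.
have cc : c <= Num.sqrt 2 * expR (- (t ^+ 2 / (4 * V))).
  rewrite ler_wpM2l ?sqrtr_ge0// ler_expR lerN2 ler_wpM2l ?sqr_ge0//.
  by rewrite lef_pV2 ?posrE ?mulr_gt0// ler_wpM2l.
apply: le_trans cc.
have : (normal_prob 0 (Num.sqrt v) [set y | (y < - t)%R] <= c%:E)%E.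
  rewrite /normal_prob.
  apply: (@le_trans _ _ (\int[lebesgue_measure]_x (c%:E * (normal_pdf 0 (Num.sqrt 2 * Num.sqrt v) x)%:E))%E); last first.
    rewrite ge0_integralZl//=.
    - by rewrite integral_normal_pdf mule1.
    - by apply/measurable_EFinP; exact: measurable_normal_pdf.
    - by move=> x _; rewrite lee_fin normal_pdf_ge0.
  apply: (@le_trans _ _ (\int[lebesgue_measure]_(x in [set y | (y < - t)%R]) (c%:E * (normal_pdf 0 (Num.sqrt 2 * Num.sqrt v) x)%:E))%E).
    apply: ge0_le_integral => //=.
    - by move=> x _; rewrite lee_fin normal_pdf_ge0.
    - by apply/measurable_EFinP; apply: measurable_funTS; exact: measurable_normal_pdf.
    - apply: measurable_funTS; under eq_fun do rewrite -EFinM.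
      by apply/measurable_EFinP; apply: measurable_funM => //; exact: measurable_normal_pdf.
    - move=> x xt; rewrite -EFinM lee_fin /c.
      rewrite -[in expR _](sqr_sqrtr (ltW v0)).
      apply: normal_pdf_tail_split => //; first exact: ltW.
      by rewrite -normrN (le_trans _ (ler_norm _))// lerNr ltW.
  apply: ge0_subset_integral => //=.
  - under eq_fun do rewrite -EFinM.
    by apply/measurable_EFinP; apply: measurable_funM => //; exact: measurable_normal_pdf.
  - by move=> x _; rewrite -EFinM lee_fin mulr_ge0// normal_pdf_ge0.
by move=> h; rewrite -lee_fin fineK// ge0_fin_numE// (le_lt_trans h) ?ltry.
Qed.

Lemma gaussian_rv_itv Y (t s : R) : gaussian_rv Y 1 -> 0 <= t -> 0 <= s ->
  s * expR (- ((t + s) ^+ 2 / 2)) / 3 <= fine (P (Y @^-1` `[t, t + s]%classic)).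
Proof.
move=> [mY law] t0 s0.
have mA : measurable `[t, t + s]%classic by exact: measurable_itv.
rewrite law// /gauss_law oner_eq0 sqrtr1.
set c := expR (- ((t + s) ^+ 2 / 2)) / 3.
have c0 : 0 <= c by rewrite divr_ge0 ?expR_ge0.
rewrite -mulrA -/c.
have : ((s * c)%:E <= normal_prob 0 1 `[t, (t + s)%R]%classic)%E.
  rewrite /normal_prob.
  apply: (@le_trans _ _ (\int[lebesgue_measure]_(x in `[t, (t + s)%R]%classic) c%:E)%E).
    rewrite integral_cst//= lebesgue_measure_itv/= lte_fin.
    have [ts|] := ltP; first by rewrite -EFinB -EFinM lee_fin addrAC subrr add0r mulrC.
    by rewrite gerDl => s1; rewrite mule0 lee_fin (_ : s = 0) ?mul0r//; apply/eqP; rewrite eq_le s1.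
  apply: ge0_le_integral => //=.
  - by apply/measurable_EFinP; apply: measurable_funTS; exact: measurable_normal_pdf.
  - move=> x; rewrite in_itv/= => /andP[tx xs]; rewrite lee_fin normal_pdfE ?oner_eq0//.
    rewrite /normal_peak /normal_fun expr1n mul1r subr0 /c mulrC.
    apply: ler_pM; rewrite ?expR_ge0 ?invr_ge0//.
      have p0 : 0 < Num.sqrt (pi *+ 2) :> R.
        by rewrite sqrtr_gt0 -mulr_natr mulr_gt0 ?pi_gt0.
      rewrite lef_pV2 ?posrE//.
      rewrite -[leRHS]ger0_norm// -sqrtr_sqr ler_wsqrtr// -mulr_natr.
      (* The crude bound [pi <= 4] already gives [sqrt (2 pi) <= 3]. *)
      by have [/andP[_]] := @pihalf_02_cos_pihalf R; lra.
    rewrite ler_expR mulNr lerN2 ler_wpM2r ?invr_ge0//.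
    have x0 : 0 <= x :> R by exact: le_trans tx.
    by rewrite lerXn2r ?nnegrE// addr_ge0.
move=> h; rewrite -lee_fin fineK// ge0_fin_numE//.
by rewrite (le_lt_trans (@probability_le1 _ _ R (normal_prob 0 1) _ mA)) ?ltry.
Qed.

End GaussianLaw.

(** * Independence through trigonometric polynomials *)

(** There are finitely many patterns, and each one is a finite intersection of the [E i] and their
    complements. This covers events that count points or quantify over components. *)
Lemma measurable_finpattern (dT : measure_display) (T : measurableType dT) (I : finType)
  (E : I -> set T) (Q : {set I} -> Prop) : (forall i, measurable (E i)) ->
  measurable [set w | Q [set i | `[< E i w >]]%SET].
Proof.
move=> mE.
have -> : [set w | Q [set i | `[< E i w >]]%SET] =
  \bigcup_(b in [set b | Q b]) \bigcap_(i in [set: I]) (if i \in b then E i else ~` E i).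
  apply/seteqP; split => [w Qw|w [b Qb bw]].
    exists [set i | `[< E i w >]]%SET => // i _; rewrite inE.
    by case: asboolP.
  rewrite /= (_ : [set i | `[< E i w >]]%SET = b)//.
  apply/setP => i; rewrite inE; have := bw i Logic.I.
  by case: (i \in b) => /= Ei; [exact/asboolP|exact/asboolPn].
apply: fin_bigcup_measurable; first exact: finite_finset.
move=> b _; apply: fin_bigcap_measurable; first exact: finite_finset.
by move=> i _; case: ifP => _ //; exact: measurableC.
Qed.

Lemma Rintegral_1 (R : realType) (dT : measure_display) (T : measurableType dT)
  (P : probability T R) : \int[P]_w (1 : R) = 1.
Proof.
rewrite /Rintegral integral_cst// mul1e.
exact: (congr1 fine (probability_setT P)).
Qed.

Section Trig.
Context {R : realType}.

(** Amplitude, frequency and phase. The phases make the class stable under multiplication by a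
    cosine without separate sine terms. *)
Definition trigpoly (L : seq (R * R * R)) (t : R) : R :=
  \sum_(p <- L) p.1.1 * cos (p.1.2 * t + p.2).

Lemma trigpoly_cst c : exists L, forall t, trigpoly L t = c.
Proof.
exists [:: (c, 0, 0)] => t.
by rewrite /trigpoly big_seq1/= mul0r addr0 cos0 mulr1.
Qed.

Lemma trigpolyD L1 L2 : exists L, forall t, trigpoly L t = trigpoly L1 t + trigpoly L2 t.
Proof. by exists (L1 ++ L2) => t; rewrite /trigpoly big_cat. Qed.

Lemma trigpolyZ c L1 : exists L, forall t, trigpoly L t = c * trigpoly L1 t.
Proof.
exists [seq (c * p.1.1, p.1.2, p.2) | p <- L1] => t.
by rewrite /trigpoly big_map mulr_sumr; apply: eq_bigr => p _; rewrite mulrA.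
Qed.

Lemma trigpoly_cosM a b L1 : exists L, forall t, trigpoly L t = trigpoly L1 t * cos (a * t + b).
Proof.
exists ([seq (p.1.1 / 2, p.1.2 + a, p.2 + b) | p <- L1] ++
        [seq (p.1.1 / 2, p.1.2 - a, p.2 - b) | p <- L1]) => t.
rewrite /trigpoly big_cat/= !big_map -big_split/= mulr_suml; apply: eq_bigr => p _ /=.
rewrite (_ : (p.1.2 + a) * t + (p.2 + b) = (p.1.2 * t + p.2) + (a * t + b)); last by ring.
rewrite (_ : (p.1.2 - a) * t + (p.2 - b) = (p.1.2 * t + p.2) - (a * t + b)); last by ring.
by rewrite cosD cosB; field.
Qed.

Lemma trigpoly_cosX a b n : exists L, forall t, trigpoly L t = cos (a * t + b) ^+ n.
Proof.
elim: n => [|n [L1 IH]]; first exact: trigpoly_cst.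
have [L LE] := trigpoly_cosM a b L1.
by exists L => t; rewrite LE IH exprSr.
Qed.

(** The mean of [trigpoly L] under the standard normal law, as [Rintegral_trigpoly] confirms. *)
Definition gauss_mean (L : seq (R * R * R)) : R :=
  \sum_(p <- L) p.1.1 * (cos p.2 * expR (- (p.1.2 ^+ 2 / 2))).

Context (dT : measure_display) (T : measurableType dT) (P : probability T R).

(* Standard normality of all linear combinations is what the field provides; product
   expectations are extracted from it in [Rintegral_prod_trigpoly]. *)
Definition iid_gaussian n (X : 'I_n -> T -> R) :=
  forall a : 'I_n -> R, gaussian_rv P (fun w => \sum_i a i * X i w) (\sum_i a i ^+ 2).

Context n (X : 'I_n -> T -> R) (iidX : iid_gaussian X).

Lemma iid_gaussian_rv i : gaussian_rv P (X i) 1.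
Proof.
have e1 : \sum_j ((j == i)%:R : R) ^+ 2 = 1.
  rewrite (bigD1 i)//= eqxx expr1n big1 ?addr0// => j /negbTE->.
  by rewrite expr0n.
have e2 w : \sum_j (j == i)%:R * X j w = X i w.
  by rewrite (bigD1 i)//= eqxx mul1r big1 ?addr0// => j /negbTE->; rewrite mul0r.
have [mXi law] := iidX (fun j => (j == i)%:R).
have e3 : (fun w => \sum_j (j == i)%:R * X j w) = X i by apply/funext => w; exact: e2.
by rewrite e3 in mXi law; rewrite e1 in law.
Qed.

Let mX i : measurable_fun setT (X i).
Proof. by have [] := iid_gaussian_rv i. Qed.

Lemma Rintegral_cos_lin (a : 'I_n -> R) b :
  \int[P]_w cos (\sum_i a i * X i w + b) = cos b * expR (- ((\sum_i a i ^+ 2) / 2)).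
Proof.
apply: Rintegral_cos_shift_gaussian; first exact: iidX.
  have := iidX (fun i => - a i).
  have -> : \sum_i (- a i) ^+ 2 = \sum_i a i ^+ 2 by apply: eq_bigr => i _; rewrite sqrrN.
  have -> // : (fun w => \sum_i - a i * X i w) = (fun w => - (\sum_i a i * X i w)).
  by apply/funext => w; rewrite -sumrN; apply: eq_bigr => i _; rewrite mulNr.
by apply: sumr_ge0 => i _; exact: sqr_ge0.
Qed.

Let m_lin (a : 'I_n -> R) b : measurable_fun setT (fun w => \sum_i a i * X i w + b).
Proof. by apply: measurable_funD => //; have [] := iidX a. Qed.

Lemma bmeas_trigpoly L i : bmeas (fun w => trigpoly L (X i w)).
Proof.
apply: bmeas_sum => p; apply: bmeasM; first exact: bmeas_cst.
by apply: bmeas_cos; apply: measurable_funD => //; apply: measurable_funM.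
Qed.

(* Product-to-sum formulas move the factors one by one into the cosine of a linear form. *)
Lemma Rintegral_prod_trigpoly_cos L (s : seq 'I_n) (a : 'I_n -> R) b :
  uniq s -> (forall i, i \in s -> a i = 0) ->
  \int[P]_w (\prod_(i <- s) trigpoly L (X i w) * cos (\sum_i a i * X i w + b)) =
  gauss_mean L ^+ size s * (cos b * expR (- ((\sum_i a i ^+ 2) / 2))).
Proof.
elim: s a b => [|j s IH] a b.
  by move=> _ _; under eq_Rintegral do rewrite big_nil mul1r;
     rewrite expr0 mul1r Rintegral_cos_lin.
move=> /= /andP[js us] as0.
have aj : a j = 0 by apply: as0; rewrite mem_head.
(* The factor at [j] turns into a frequency [c] in coordinate [j]. Since [a j = 0], the sum of
   squares grows by [c ^+ 2] with no cross term. *)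
pose a' c i := a i + c * (i == j)%:R.
have a's c i : i \in s -> a' c i = 0.
  move=> si; rewrite /a' as0 ?inE ?si ?orbT// (_ : (i == j) = false) ?mulr0 ?addr0//.
  by apply/negbTE; apply: contraNneq js => <-.
have a'X c w : \sum_i a' c i * X i w = \sum_i a i * X i w + c * X j w.
  rewrite /a'; under eq_bigr do rewrite mulrDl.
  rewrite big_split/=; congr (_ + _); rewrite (bigD1 j)//= eqxx mulr1 big1 ?addr0//.
  by move=> i /negbTE->; rewrite mulr0 mul0r.
have a'2 c : \sum_i a' c i ^+ 2 = \sum_i a i ^+ 2 + c ^+ 2.
  rewrite (bigD1 j)//= [in RHS](bigD1 j)//= /a' eqxx aj mulr1 add0r expr0n add0r addrC.
  congr (_ + _); apply: eq_bigr => i /negbTE->; by rewrite mulr0 addr0.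
pose F (p : R * R * R) w :=
  \prod_(i <- s) trigpoly L (X i w) * cos (\sum_i a' p.1.2 i * X i w + (b + p.2)) +
  \prod_(i <- s) trigpoly L (X i w) * cos (\sum_i a' (- p.1.2) i * X i w + (b - p.2)).
have bF c e : bmeas (fun w => \prod_(i <- s) trigpoly L (X i w) * cos (\sum_i a' c i * X i w + e)).
  apply: bmeasM; last exact: bmeas_cos.
  by apply: bmeas_prod => i; exact: bmeas_trigpoly.
transitivity (\int[P]_w (\sum_(p <- L) p.1.1 / 2 * F p w)).
  apply: eq_Rintegral => w _; rewrite big_cons {1}/trigpoly !mulr_suml.
  apply: eq_bigr => p _; rewrite /F !a'X.
  rewrite (_ : _ + p.1.2 * X j w + (b + p.2) = (\sum_i a i * X i w + b) + (p.1.2 * X j w + p.2)); last by ring.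
  rewrite (_ : _ + - p.1.2 * X j w + (b - p.2) = (\sum_i a i * X i w + b) - (p.1.2 * X j w + p.2)); last by ring.
  set U := \sum_i _ + b; set V := p.1.2 * _ + _; set Q := \prod_(i <- s) _.
  by clearbody U V Q; rewrite cosD cosB; field.
have bFp p : bmeas (F p) by apply: bmeasD; exact: bF.
rewrite Rintegral_sum_bmeas; last by move=> p; apply: bmeasM; [exact: bmeas_cst|exact: bFp].
rewrite exprSr -mulrA [gauss_mean L * _]mulr_suml mulr_sumr; apply: eq_bigr => p _.
rewrite RintegralZ_bmeas// RintegralD_bmeas; [|exact: bF..].
rewrite !IH//; try exact: a's.
rewrite !a'2 sqrrN mulrDl opprD expRD cosD cosB.
by field.
Qed.

Lemma Rintegral_trigpoly L i : \int[P]_w trigpoly L (X i w) = gauss_mean L.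
Proof.
have := @Rintegral_prod_trigpoly_cos L [:: i] (fun=> 0) 0 isT (fun _ _ => erefl).
rewrite expr1 cos0 mul1r (eq_bigr (fun=> 0)); last by move=> ? _; rewrite expr0n.
rewrite big1_eq mul0r oppr0 expR0 mulr1 => <-; apply: eq_Rintegral => w _.
rewrite big_seq1 big1 ?addr0 ?cos0 ?mulr1// => ? _; by rewrite mul0r.
Qed.

Lemma Rintegral_prod_trigpoly L :
  \int[P]_w \prod_i trigpoly L (X i w) = gauss_mean L ^+ n.
Proof.
have := @Rintegral_prod_trigpoly_cos L (enum 'I_n) (fun=> 0) 0 (enum_uniq _) (fun _ _ => erefl).
rewrite size_enum_ord cos0 mul1r (eq_bigr (fun=> 0)); last by move=> ? _; rewrite expr0n.
rewrite big1_eq mul0r oppr0 expR0 mulr1 => <-; apply: eq_Rintegral => w _.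
have -> : \sum_i 0 * X i w = 0 by rewrite big1// => i _; rewrite mul0r.
by rewrite big_enum/= addr0 cos0 mulr1.
Qed.

Lemma bernoulli_ineq (x : R) k : 0 <= x <= 1 -> 1 - k%:R * x <= (1 - x) ^+ k.
Proof.
move=> /andP[x0 x1]; elim: k => [|k IH]; first by rewrite mul0r subr0 expr0.
rewrite exprS; apply: (@le_trans _ _ ((1 - x) * (1 - k%:R * x))).
  by rewrite -natr1; have := ler0n R k; nra.
by rewrite ler_wpM2l// subr_ge0.
Qed.

(** Each of the at most [N - 1] exceptional factors is at least 1/2; the others are at least
    [1 - 1 / (2 n)], and by Bernoulli they cost together only one more factor 1/2. *)
Lemma prod_ge_half (A : pred 'I_n) (y : 'I_n -> R) N : (0 < n)%N -> (#|A| < N)%N ->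
  (forall i, 0 <= y i <= 1) -> (forall i, ~~ A i -> y i <= n%:R^-1) ->
  2%:R^-1 ^+ N <= \prod_i (1 - y i / 2).
Proof.
move=> n0 AN y01 yA.
have n0R : (0 < n%:R :> R) by rewrite ltr0n.
have n1 : 1 <= n%:R :> R by rewrite (ler_nat R 1).
rewrite (bigID A)/=.
have h1 : 2%:R^-1 ^+ #|A| <= \prod_(i | A i) (1 - y i / 2).
  rewrite -prodr_const; apply: ler_prod => i _.
  by have := y01 i; rewrite invr_ge0/=; lra.
have h2 : 2^-1 <= \prod_(i | ~~ A i) (1 - y i / 2).
  apply: (@le_trans _ _ ((1 - (2 * n%:R)^-1) ^+ n)).
    apply: le_trans (bernoulli_ineq _ _).
      by rewrite (_ : 1 - _ = 2^-1)//; field; rewrite gt_eqF.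
    rewrite invr_ge0 mulr_ge0//= invf_le1 ?mulr_gt0//.
    by lra.
  have r0 : 0 <= (2 * n%:R)^-1 :> R by rewrite invr_ge0 mulr_ge0.
  have r1 : (2 * n%:R)^-1 <= 1 :> R by rewrite invf_le1 ?mulr_gt0//; lra.
  have q0 : 0 <= 1 - (2 * n%:R)^-1 :> R by lra.
  have q1 : 1 - (2 * n%:R)^-1 <= 1 :> R by lra.
  apply: (@le_trans _ _ (\prod_(i | ~~ A i) (1 - (2 * n%:R)^-1))).
    rewrite prodr_const ler_wiXn2l ?q0 ?q1//.
    by rewrite -[leqRHS]card_ord max_card.
  apply: ler_prod => i Ai; rewrite q0/= lerD2l lerN2.
  by rewrite invfM [leLHS]mulrC ler_wpM2l// yA.
apply: (@le_trans _ _ (2^-1 ^+ #|A| * 2^-1)); last first.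
  by apply: ler_pM => //; rewrite ?exprn_ge0 ?invr_ge0.
rewrite -exprSr ler_wiXn2l// ?invr_ge0// invf_le1//; lra.
Qed.

(** Markov's inequality for the product of the [1 - trigpoly L (X i) / 2], whose mean factorizes
    exactly. On the event this product is at least [2 ^- N] by [prod_ge_half], unless some variable
    lies below [- Lam], outside the range where [L] is controlled. *)
Lemma few_large_prob L (h Lam q : R) N : (0 < n)%N ->
  (forall t, 0 <= trigpoly L t <= 1) ->
  (forall t, - Lam <= t -> t < h -> trigpoly L t <= n%:R^-1) ->
  q <= gauss_mean L -> q <= 1 -> 0 < Lam ->
  fine (P [set w | (#|[pred i | (h <= X i w)%R]| < N)%N]) <=
  2 ^+ N * (1 - q / 2) ^+ n + n%:R * (Num.sqrt 2 * expR (- (Lam ^+ 2 / 4))).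
Proof.
move=> n0 L01 Lh qL q1 Lam0.
have [L' L'E] : exists L', forall t, trigpoly L' t = 1 - trigpoly L t / 2.
  have [L1 L1E] := trigpoly_cst 1; have [L2 L2E] := trigpolyZ (- 2^-1) L.
  have [L3 L3E] := trigpolyD L1 L2.
  by exists L3 => t; rewrite L3E L1E L2E mulNr mulrC.
have mL' : gauss_mean L' = 1 - gauss_mean L / 2.
  pose i0 := Ordinal n0.
  rewrite -(Rintegral_trigpoly L' i0) -(Rintegral_trigpoly L i0).
  have L'E2 t : trigpoly L' t = 1 + - 2^-1 * trigpoly L t by rewrite L'E mulNr mulrC.
  under eq_Rintegral do rewrite L'E2.
  rewrite RintegralD_bmeas; [|exact: bmeas_cst|apply: bmeasM; [exact: bmeas_cst|exact: bmeas_trigpoly]].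
  rewrite RintegralZ_bmeas; last exact: bmeas_trigpoly.
  by rewrite (Rintegral_1 P) mulNr [_ / 2]mulrC.
have mlow i : measurable (X i @^-1` [set y | (y < - Lam)%R]).
  rewrite -[X in measurable X]setTI; apply: mX => //.
  by have := measurable_itv `]-oo, (- Lam)[; rewrite set_itvE.
pose B := [set w | (#|[pred i | (h <= X i w)%R]| < N)%N].
have mB : measurable B.
  rewrite (_ : B = [set w | (#|[set i | `[< X i w \in `[h, +oo[ >]]%SET| < N)%N]).
    apply: (@measurable_finpattern _ _ _ (fun i => [set w | X i w \in `[h, +oo[]) (fun S => (#|S| < N)%N)) => i.
    have -> : [set w | X i w \in `[h, +oo[] = setT `&` (X i @^-1` `[h, +oo[%classic) by rewrite setTI.
    exact: mX.
  apply/funext => w; rewrite /B/=; congr (is_true (_ < _)%N); apply: eq_card => i.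
  by rewrite finset.in_set asboolb in_itv/= andbT inE.
pose g w := 2 ^+ N * \prod_i trigpoly L' (X i w) + \sum_i \1_(X i @^-1` [set y | (y < - Lam)%R]) w.
have bg1 : bmeas (fun w => \prod_i trigpoly L' (X i w)).
  by apply: bmeas_prod => i; exact: bmeas_trigpoly.
have bg2 i : bmeas (\1_(X i @^-1` [set y | (y < - Lam)%R]) : T -> R) by exact: bmeas_indic.
have bg3 : bmeas (fun w => \sum_i \1_(X i @^-1` [set y | (y < - Lam)%R]) w : R).
  exact: bmeas_sum.
have L'0 t : 0 <= trigpoly L' t by rewrite L'E; have := L01 t; lra.
have gA w : 0 <= 2 ^+ N * \prod_i trigpoly L' (X i w).
  by rewrite mulr_ge0 ?exprn_ge0// prodr_ge0.
have gB (p : pred 'I_n) w : 0 <= \sum_(i | p i) \1_(X i @^-1` [set y | (y < - Lam)%R]) w :> R.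
  by rewrite sumr_ge0// => i _; rewrite indicE.
have g0 w : 0 <= g w by rewrite addr_ge0.
have Bg w : B w -> 1 <= g w.
  rewrite /B/= => Bw; have [/existsP[i Xi]|/existsPn noX] := boolP [exists i, X i w < - Lam].
    have ind1 : \1_(X i @^-1` [set y | (y < - Lam)%R]) w = 1 :> R by rewrite indicE mem_set.
    have e : \sum_j \1_(X j @^-1` [set y | (y < - Lam)%R]) w = \1_(X i @^-1` [set y | (y < - Lam)%R]) w +
        \sum_(j | j != i) \1_(X j @^-1` [set y | (y < - Lam)%R]) w :> R by exact: bigD1.
    by rewrite /g e ind1 addrCA lerDl addr_ge0//; exact: (gB (predC1 i)).
  rewrite /g -[leLHS]addr0 lerD//.
  have := @prod_ge_half [pred i | h <= X i w] (fun i => trigpoly L (X i w)) N n0 Bw.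
  under eq_bigr do rewrite -L'E.
  move=> hh; have {hh} : 2^-1 ^+ N <= \prod_i trigpoly L' (X i w).
    apply: hh => [i|i]; first exact: L01.
    rewrite inE -ltNge => Xh; apply: Lh => //.
    by have := noX i; rewrite -leNgt.
  by rewrite exprVn -(@ler_pM2l _ (2 ^+ N)) ?exprn_gt0// mulfV ?expf_neq0// pnatr_eq0.
have b1 : bmeas (fun w => 2 ^+ N * \prod_i trigpoly L' (X i w)).
  by apply: bmeasM => //; exact: bmeas_cst.
apply: le_trans (@fine_prob_le _ _ _ P g B 1 ltr01 mB (bmeasD b1 bg3) g0 Bg) _.
rewrite invr1 mul1r RintegralD_bmeas// RintegralZ_bmeas// Rintegral_sum_bmeas//.
rewrite Rintegral_prod_trigpoly mL' lerD//.
  rewrite ler_wpM2l ?exprn_ge0//.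
  have gm1 : gauss_mean L <= 1.
    rewrite -(Rintegral_trigpoly L (Ordinal n0)).
    apply: (@le_trans _ _ (\int[P]_w (fun=> 1) w)).
      apply: le_Rintegral_bmeas; [exact: bmeas_trigpoly|exact: bmeas_cst|].
      by move=> w; have /andP[] := L01 (X (Ordinal n0) w).
    by rewrite (Rintegral_1 P).
  by rewrite lerXn2r ?nnegrE; lra.
rewrite mulr_natl -[X in _ *+ X]card_ord -sumr_const; apply: ler_sum => i _.
rewrite Rintegral_indic// -[4]mulr1.
by apply: gaussian_rv_lt (iid_gaussian_rv i) _ _ Lam0 => //; rewrite lexx ler01.
Qed.

End Trig.

(** * Trees in the hypercube *)

Section Tree.
Context {d : nat}.
Implicit Types (x y z : zpoint d).

Definition flip x (i : 'I_d) : zpoint d := [ffun j => if j == i then 1 - x j else x j].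

Lemma flip_in_cube x i : in_cube x -> in_cube (flip x i).
Proof.
move=> /forallP cx; apply/forallP => j; rewrite ffunE.
have := cx j; case: ifP => // _ /orP[] /eqP ->; first by rewrite subr0 eqxx orbT.
by rewrite subrr eqxx.
Qed.

Lemma flipE x i : in_cube x -> flip x i i != x i.
Proof.
by move=> /forallP/(_ i); rewrite ffunE eqxx => /orP[] /eqP ->.
Qed.

Lemma flip_other x i j : j != i -> flip x i j = x j.
Proof. by rewrite ffunE => /negbTE->. Qed.

Lemma flip_inj x : in_cube x -> injective (flip x).
Proof.
move=> cx i j e; apply/eqP; apply: contraT => ij.
by have := flipE i cx; rewrite e flip_other// eqxx.
Qed.

Lemma nbr_sym x y : nbr x y = nbr y x.
Proof. by rewrite /nbr; congr (_ == _); apply: eq_bigr => i _; rewrite distrC. Qed.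

Lemma nbr_flip x i : in_cube x -> nbr x (flip x i).
Proof.
move=> /forallP/(_ i) xi; rewrite /nbr (bigD1 i)//= big1 ?addr0.
  by rewrite ffunE eqxx; case/orP: xi => /eqP ->.
by move=> j ji; rewrite flip_other// subrr normr0.
Qed.

(** Two distinct flips of [x] differ in two coordinates, and a shift changes only one. *)
Lemma shift_flip_neq x (i j : 'I_d) k s : in_cube x -> i != j ->
  Defs.shift (flip x i) k s != flip x j.
Proof.
move=> cx ij; apply/eqP => /ffunP e.
have [ki|ki] := eqVneq k i.
  have := e j; rewrite ffunE ki eq_sym (negbTE ij) flip_other 1?eq_sym//.
  by apply/eqP; rewrite eq_sym; exact: flipE.
have := e i; rewrite ffunE eq_sym (negbTE ki) (flip_other _ ij).
by apply/eqP; exact: flipE.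
Qed.

Definition joined (C : seq (zpoint d)) u v :=
  exists p : seq (zpoint d), [&& path (@nbr d) u p, last u p == v & all (mem C) p].

Lemma joined_refl C u : joined C u u.
Proof. by exists [::]; rewrite /= eqxx. Qed.

Lemma joined_trans C u v w : joined C u v -> joined C v w -> joined C u w.
Proof.
move=> [p /and3P[p1 /eqP p2 p3]] [q /and3P[q1 q2 q3]].
by exists (p ++ q); rewrite cat_path p1 p2 q1 last_cat p2 q2 all_cat p3 q3.
Qed.

Lemma joined1 C u v : nbr u v -> v \in C -> joined C u v.
Proof. by move=> uv vC; exists [:: v]; rewrite /= uv eqxx vC. Qed.

Lemma joined_sym C u v : u \in C -> joined C u v -> joined C v u.
Proof.
move=> uC [p /and3P[p1 /eqP <- p3]]; elim: p u uC p1 p3 => [|y p IH] u uC /=.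
  by move=> _ _; exact: joined_refl.
move=> /andP[uy yp] /andP[yC pC].
apply: joined_trans (IH _ yC yp pC) _.
by apply: joined1 => //; rewrite nbr_sym.
Qed.

Lemma joined_sub C C' u v : {subset C <= C'} -> joined C u v -> joined C' u v.
Proof.
move=> CC [p /and3P[p1 p2 p3]]; exists p; rewrite p1 p2 /=.
by apply: sub_all p3 => z; exact: CC.
Qed.

Context (M : nat) (K : nat) (KM : (K * M <= d)%N).

Lemma blk_subproof s (j : 'I_M) : (s < K)%N -> (s * M + j < d)%N.
Proof. by move=> sK; have := ltn_ord j; nia. Qed.

(* Coordinates [s * M, ..., s * M + M - 1] form block [s]; [blk s j] is [None], and [child] the
   identity, for blocks that stick out of [0, d). *)
Definition blk (s : nat) (j : 'I_M) : option 'I_d := insub (s * M + j)%N.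

Definition child x (s : nat) (j : 'I_M) : zpoint d :=
  if blk s j is Some i then flip x i else x.

Lemma childE x s j (sK : (s < K)%N) : child x s j = flip x (Ordinal (blk_subproof j sK)).
Proof.
rewrite /child /blk; case: insubP => [i _ ij|/negP[]]; last exact: blk_subproof.
by congr flip; apply: val_inj.
Qed.

(* The last letter of the word is the first flip, made in block 0: a word of length [s] flips
   one coordinate in each of the blocks [0, ..., s - 1]. *)
Fixpoint word_point x (w : seq 'I_M) : zpoint d :=
  if w is j :: w' then child (word_point x w') (size w') j else x.

Lemma word_point_in_cube x w : in_cube x -> in_cube (word_point x w).
Proof.
move=> cx; elim: w => //= j w IH; rewrite /child; case: (blk _ _) => // i.
exact: flip_in_cube.
Qed.

(** Induction on the number [k] of generations left. The component keeps the coordinates of its root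
    in all blocks already used, which keeps the subtrees of different children disjoint: they
    already differ in the block where the children were formed. *)
Lemma tree_component (opn : zpoint d -> bool) (N : nat) x : in_cube x ->
  (forall w : seq 'I_M, (size w < K)%N ->
     (N <= #|[pred j | opn (word_point x (j :: w))]|)%N) ->
  forall k (w : seq 'I_M), (size w + k = K)%N -> opn (word_point x w) ->
  exists C : seq (zpoint d),
    [/\ uniq C, all (fun z => in_cube z && opn z) C, word_point x w \in C,
       (forall z, z \in C -> joined C (word_point x w) z /\
          (forall i : 'I_d, (i < size w * M)%N -> z i = word_point x w i)) &
       (N ^ k <= size C)%N].
Proof.
move=> cx good; elim=> [|k IH] w wk ow.
  exists [:: word_point x w]; split => //=; first by rewrite word_point_in_cube// ow.
    by rewrite mem_head.
  move=> z; rewrite inE => /eqP ->; split => //; exact: joined_refl.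
have wK : (size w < K)%N by lia.
have /choice[F FP] : forall j, exists C : seq (zpoint d), opn (word_point x (j :: w)) ->
    [/\ uniq C, all (fun z => in_cube z && opn z) C, word_point x (j :: w) \in C,
       (forall z, z \in C -> joined C (word_point x (j :: w)) z /\
          (forall i : 'I_d, (i < (size w).+1 * M)%N -> z i = word_point x (j :: w) i)) &
       (N ^ k <= size C)%N].
  move=> j; have [oj|oj] := boolP (opn (word_point x (j :: w))); last by exists [::].
  by have [|C CP] := IH (j :: w) _ oj; [rewrite /=; lia|exists C].
set v := word_point x w.
have cv : in_cube v by exact: word_point_in_cube.
pose J := enum [pred j | opn (word_point x (j :: w))].
have Jo j : j \in J -> opn (word_point x (j :: w)) by rewrite mem_enum.
pose bi j := Ordinal (blk_subproof j wK).
have wpj j : word_point x (j :: w) = flip v (bi j) by rewrite /= (childE _ _ wK).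
have bi_lt j : (bi j < (size w).+1 * M)%N by rewrite /=; have := ltn_ord j; nia.
have bi_inj : injective bi.
  by move=> j j' /(congr1 val) /= /addnI e; apply: val_inj.
(* Inside the subtree of [j], the only coordinate of the current block that differs from [v] is the
   one flipped to reach [j]. Both the disjointness of the subtrees and [v \notin U] follow. *)
have Fbi j j' z : j \in J -> z \in F j -> (z (bi j') == v (bi j')) = (j' != j).
  move=> /Jo/FP[_ _ _ Fz _] zF; have [_ ->//] := Fz _ zF; rewrite wpj.
  have [->|jj] := eqVneq j' j; first exact/negbTE/flipE.
  by rewrite flip_other ?eqxx// (inj_eq bi_inj).
pose U := flatten [seq F j | j <- J].
have UP z : reflect (exists2 j, j \in J & z \in F j) (z \in U).
  apply: (iffP flattenP) => [[C /mapP[j jJ ->] zF]|[j jJ zF]]; first by exists j.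
  by exists (F j) => //; apply/mapP; exists j.
have uU : uniq U.
  rewrite /U; have : uniq J by exact: enum_uniq.
  have : {subset J <= J} by [].
  elim: {1 3 4}J => //= j s IHs sJ /andP[js us].
  have jJ : j \in J by apply: sJ; rewrite mem_head.
  have sJ' : {subset s <= J} by move=> i si; apply: sJ; rewrite inE si orbT.
  rewrite cat_uniq IHs// andbT; have [-> _ _ _ _] := FP _ (Jo _ jJ).
  apply/hasPn => z /flattenP[C /mapP[j' j's ->] zF']; apply/negP => zF.
  have := Fbi j j z jJ zF; rewrite (Fbi j' j z (sJ' _ j's) zF') eqxx/=.
  by move/negbFE/eqP => jj; rewrite jj j's in js.
have vU : v \notin U.
  apply/negP => /UP[j jJ vF]; have := Fbi j j v jJ vF; by rewrite !eqxx.
exists (v :: U); split.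
- by rewrite /= vU.
- rewrite /= ow cv/=; apply/allP => z /UP[j jJ zF].
  by have [_ /allP aF _ _ _] := FP _ (Jo _ jJ); exact: aF.
- by rewrite mem_head.
- move=> z; rewrite inE => /predU1P[->|/UP[j jJ zF]]; first by split=> //; exact: joined_refl.
  have [_ _ jF Fz _] := FP _ (Jo _ jJ); have [jz eqz] := Fz _ zF.
  have FU : {subset F j <= v :: U}.
    by move=> y yF; rewrite inE; apply/orP; right; apply/UP; exists j.
  split.
    apply: joined_trans (joined_sub FU jz); apply: joined1; last exact: FU.
    by rewrite wpj; exact: nbr_flip.
  move=> i iw; rewrite eqz; last by nia.
  rewrite wpj flip_other//; apply/eqP => /(congr1 val) /= e; lia.
- have sU : size U = (\sum_(j <- J) size (F j))%N.
    by rewrite /U size_flatten /shape -map_comp sumnE big_map.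
  (* The root [v] is dropped from the count; the bound counts only the leaves. *)
  rewrite /= sU; apply: leqW.
  apply: (@leq_trans (\sum_(j <- J) N ^ k)%N).
    rewrite big_const_seq count_predT iter_addn_0 expnS mulnC leq_mul2l.
    by rewrite -cardE good ?orbT.
  rewrite big_seq [leqRHS]big_seq; apply: leq_sum => j jJ.
  by have [] := FP _ (Jo _ jJ).
Qed.

End Tree.

(** * Percolation of the free field *)

Section FreeField.
Context {R : realType} {d : nat} (dT : measure_display) (T : measurableType dT)
  (P : probability T R) (phi : zpoint d -> {RV P >-> R}).
Hypothesis gff : is_GFF phi.
Hypothesis d20 : (20 <= d)%N.
Implicit Types (x y z : zpoint d).

Let field (w : T) (z : zpoint d) : R := phi z w.

Lemma measurable_lform l : measurable_fun setT (fun w => lform (field w) l).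
Proof.
rewrite /lform; elim: l => [|p l IH].
  by under eq_fun do rewrite big_nil; exact: measurable_cst.
under eq_fun do rewrite big_cons; apply: measurable_funD => //.
by apply: measurable_funM => //; exact: measurable_funP.
Qed.

Lemma gaussian_lform l : gaussian_rv P (fun w => lform (field w) l) (gform l l).
Proof. by split; [exact: measurable_lform|move=> A mA; exact: gff_lform]. Qed.

Lemma iid_innov n (z : 'I_n -> zpoint d) : injective z ->
  (forall i j k s, s != 0 -> Defs.shift (z i) k s != z j) ->
  iid_gaussian P (fun i w => lform (field w) (innov (z i))).
Proof.
move=> z_inj zz a.
have := gaussian_lform (combine_forms a (fun i => innov (z i))).
have -> : (fun w => lform (field w) (combine_forms a (fun i => innov (z i)))) =
    (fun w => \sum_i a i * lform (field w) (innov (z i))).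
  by apply/funext => w; rewrite lform_combine.
rewrite gform_combine; congr gaussian_rv; apply: eq_bigr => i _.
rewrite (bigD1 i)//= gform_innov//; last by move=> k s; exact: zz.
rewrite eqxx mulr1 big1 ?addr0 ?expr2// => j ji.
rewrite gform_innov//; last by move=> k s; exact: zz.
by rewrite (inj_eq z_inj) eq_sym (negbTE ji) mulr0.
Qed.

Lemma avg_field_lt z : fine (P [set w | (avg (field w) z < - 1)%R]) <=
  Num.sqrt 2 * expR (- (d%:R / 8)).
Proof.
have g := gaussian_lform (avgl z); rewrite gform_avgl// in g.
have d0 : (0 < d%:R :> R) by rewrite ltr0n; lia.
have := gaussian_rv_lt (V := 2 / d%:R) (t := 1) g.
have -> : (fun w => lform (field w) (avgl z)) @^-1` [set y | (y < - 1)%R] =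
    [set w | (avg (field w) z < - 1)%R].
  by apply/seteqP; split => w /=; rewrite lform_avgl.
have -> : 1 ^+ 2 / (4 * (2 / d%:R)) = d%:R / 8 :> R by field; rewrite gt_eqF.
apply => //; last by rewrite divr_gt0.
apply/andP; split; last first.
  by have := @green_le R d d20 (origin d) (origin d); lra.
rewrite subr_ge0.
rewrite greenE// eqxx lerDl.
rewrite /avg mulr_ge0 ?invr_ge0// sumr_ge0// => y _.
rewrite -(cvg_lim (@Rhausdorff R) (@cvg_green R d d20 y (origin d))).
apply: limr_ge; first by apply/cvg_ex; eexists; exact: cvg_green.
by apply: nearW => n; rewrite /series/= sumr_ge0// => k _; exact: srw_p_ge0.
Qed.

(** The cube is coded by a finite type so that [measurable_finpattern] applies to the set of its
    points above the level. *)
Definition cube_point (b : {ffun 'I_d -> bool}) : zpoint d := [ffun i => (b i : nat)%:Z].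

Definition cube_code z : {ffun 'I_d -> bool} := [ffun i => z i == 1].

Lemma cube_codeK z : in_cube z -> cube_point (cube_code z) = z.
Proof.
move=> /forallP cz; apply/ffunP => i; rewrite !ffunE.
by have /orP[] := cz i => /eqP ->.
Qed.

Lemma substantial_ext eps (K1 K2 : zpoint d -> bool) (C : seq (zpoint d)) : K1 =1 K2 ->
  substantial (R := R) eps K1 C -> substantial eps K2 C.
Proof. by move=> K12 [uC aC cC sC]; split => //; rewrite -(eq_all K12). Qed.

Definition perc_event x (eps h : R) : set T :=
  [set w | exists y, nbr x y /\ exists C : seq (zpoint d), y \in C /\
     substantial eps (fun z => in_cube z && (h <= field w z)) C].

Lemma measurable_perc_event x eps h : measurable (perc_event x eps h).
Proof.
pose Q (S : {set {ffun 'I_d -> bool}}) := exists y, nbr x y /\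
  exists C : seq (zpoint d), y \in C /\
     substantial eps (fun z => in_cube z && (cube_code z \in S)) C.
pose E b := [set w | h <= field w (cube_point b)].
have -> : perc_event x eps h = [set w | Q [set b | `[< E b w >]]%SET].
  have ext w : (fun z => in_cube z && (h <= field w z)) =1
      (fun z => in_cube z && (cube_code z \in [set b | `[< E b w >]]%SET)).
    move=> z; case cz : (in_cube z) => //=.
    by rewrite finset.in_set asboolb/= cube_codeK.
  by apply/seteqP; split => w [y [xy [C [yC sC]]]]; exists y; split=> //; exists C; split=> //;
    move: sC; apply: substantial_ext => z; rewrite ext.
apply: measurable_finpattern => b.
have -> : E b = setT `&` (phi (cube_point b) @^-1` `[h, +oo[%classic).
  by rewrite setTI; apply/seteqP; split => w /=; rewrite in_itv/= andbT.
exact: (measurable_funP (phi (cube_point b))).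
Qed.

(** * The tree argument at a fixed level *)

Section Percolation.
Variables (x : zpoint d) (eps h p2 : R) (M K N : nat).
Hypotheses (cx : in_cube x) (KM : (K.+1 * M <= d)%N) (N0 : (0 < N)%N).
Hypothesis substN :
  (Num.floor (d%:R `^ eps / bconst eps))%:~R `^ (bconst eps - 1) <= (N ^ K)%:R.
Hypothesis p2P : forall X : 'I_M -> T -> R, iid_gaussian P X ->
  fine (P [set w | (#|[pred i | (h + 1 <= X i w)%R]| < N)%N]) <= p2.

Let few_innov (w : seq 'I_M) : set T :=
  [set t | (#|[pred j | (h + 1 <= lform (field t) (innov (word_point x (j :: w))))%R]| < N)%N].

Let low_avg (w : seq 'I_M) : set T := [set t | (avg (field t) (word_point x w) < - 1)%R].

(** An innovation of at least [h + 1] and a neighbour average of at least [- 1] add up to a field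
    value of at least [h]. *)
Let goodP t : (forall w : seq 'I_M, (size w < K.+1)%N ->
    ~ few_innov w t /\ forall j, ~ low_avg (j :: w) t) -> perc_event x eps h t.
Proof.
move=> good; pose opn z := h <= field t z.
have many (w : seq 'I_M) : (size w < K.+1)%N ->
    (N <= #|[pred j | opn (word_point x (j :: w))]|)%N.
  move=> wK; have [/negP few low] := good _ wK; move: few; rewrite -leqNgt => /leq_trans; apply.
  apply: subset_leq_card; apply/fintype.subsetP => j; rewrite !inE lform_innov /opn => hj.
  by have /negP := low j; rewrite -leNgt; lra.
(* The root [x] may be below the level, so the component grows from one of its open children; [N0]
   guarantees that there is one. *)
have [j0 oj0] : exists j0 : 'I_M, opn (word_point x [:: j0]).
  have := many [::] isT; case: (pickP (fun j : 'I_M => opn (word_point x [:: j]))) => [j oj _|e].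
    by exists j.
  by rewrite (eq_card0 e); move: N0; case: N.
have [C [uC aC rC jC sC]] := tree_component KM cx many (w := [:: j0]) (add1n K) oj0.
exists (word_point x [:: j0]); split.
  by rewrite /= (@childE _ _ _ KM)//; exact: nbr_flip.
exists C; split=> //; split=> //.
  move=> u v uC' vC; have [ju _] := jC _ uC'; have [jv _] := jC _ vC.
  exact: joined_trans (joined_sym rC ju) jv.
by apply: le_trans substN _; rewrite ler_nat.
Qed.

Let m_few w : measurable (few_innov w).
Proof.
rewrite /few_innov.
pose E (j : 'I_M) : set T := [set t | h + 1 <= lform (field t) (innov (word_point x (j :: w)))].
rewrite (_ : [set t | _] = [set t | (#|[set j | `[< E j t >]]%SET| < N)%N]).
  apply: (@measurable_finpattern _ _ _ E (fun S => (#|S| < N)%N)) => j.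
  have -> : E j = setT `&` ((fun t => lform (field t) (innov (word_point x (j :: w)))) @^-1` `[h + 1, +oo[%classic).
    by rewrite setTI; apply/seteqP; split => t /=; rewrite in_itv/= andbT.
  exact: measurable_lform.
apply/funext => t; congr (is_true (_ < _)%N); apply: eq_card => j.
by rewrite finset.in_set asboolb inE.
Qed.

Let m_low w : measurable (low_avg w).
Proof.
have -> : low_avg w = setT `&` ((fun t => lform (field t) (avgl (word_point x w))) @^-1` `]-oo, - 1[%classic).
  by rewrite setTI; apply/seteqP; split => t /=; rewrite in_itv/= lform_avgl.
exact: measurable_lform.
Qed.

Let P_few (w : seq 'I_M) : (size w < K.+1)%N -> fine (P (few_innov w)) <= p2.
Proof.
move=> wK; apply: p2P; have cw := word_point_in_cube w cx.
have wpj (j : 'I_M) : word_point x (j :: w) = flip (word_point x w) (Ordinal (blk_subproof KM j wK)).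
  by rewrite /= (childE KM).
apply: iid_innov.
  move=> i j; rewrite !wpj => /(flip_inj cw)/(congr1 val)/= /addnI e.
  exact: val_inj.
move=> i j k s s0; rewrite !wpj.
have [->|ij] := eqVneq i j; first by rewrite shift_neq.
apply: shift_flip_neq => //.
by rewrite -(inj_eq val_inj)/= eqn_add2l (inj_eq val_inj).
Qed.

(** There are [K.+1] depths and at most [d ^ K] words at each. A word costs [p2] for having few high
    innovations, plus one Gaussian tail for each of its at most [d] children. *)
Lemma perc_event_prob :
  1 - K.+1%:R * d%:R ^+ K * (p2 + d%:R * (Num.sqrt 2 * expR (- (d%:R / 8)))) <=
  fine (P (perc_event x eps h)).
Proof.
(* The number of failures. Outside the percolation event it is at least 1, so its mean bounds the
   probability of the complement. *)
pose bad t : R := \sum_(k < K.+1) \sum_(w : k.-tuple 'I_M)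
  (\1_(few_innov w) t + \sum_j \1_(low_avg (j :: w)) t).
have bm1 (k : 'I_K.+1) (w : k.-tuple 'I_M) : bmeas (fun t => \sum_j \1_(low_avg (j :: w)) t : R).
  by apply: bmeas_sum => j; exact: bmeas_indic.
have bm2 (k : 'I_K.+1) (w : k.-tuple 'I_M) :
    bmeas (fun t => \1_(few_innov w) t + \sum_j \1_(low_avg (j :: w)) t : R).
  by apply: bmeasD => //; exact: bmeas_indic.
have bm3 (k : 'I_K.+1) : bmeas (fun t => \sum_(w : k.-tuple 'I_M)
    (\1_(few_innov w) t + \sum_j \1_(low_avg (j :: w)) t) : R).
  exact: bmeas_sum.
have bmb : bmeas bad by exact: bmeas_sum.
have mE := measurable_perc_event x eps h.
have bmE : bmeas (\1_(perc_event x eps h) : T -> R) by exact: bmeas_indic.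
have tot : 1 <= fine (P (perc_event x eps h)) + \int[P]_t bad t.
  rewrite -(Rintegral_1 P) -Rintegral_indic// -RintegralD_bmeas//.
  apply: le_Rintegral_bmeas; [exact: bmeas_cst|exact: bmeasD|] => t.
  have ge0 : 0 <= bad t.
    by do 2 (apply: sumr_ge0 => ? _); rewrite addr_ge0 ?sumr_ge0// indicE.
  rewrite indicE; case: (boolP (t \in _)) => [_|/negP tE]; first by rewrite lerDl.
  rewrite add0r leNgt; apply/negP => bad1; apply: tE; rewrite inE; apply: goodP => w wK.
  have term_le : \1_(few_innov w) t + \sum_j \1_(low_avg (j :: w)) t <= bad t.
    rewrite /bad (bigD1 (Ordinal wK))//= (bigD1 (in_tuple w))//= -addrA lerDl addr_ge0//.
      by apply: sumr_ge0 => ? _; rewrite addr_ge0 ?sumr_ge0// indicE.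
    by do 2 (apply: sumr_ge0 => ? _); rewrite addr_ge0 ?sumr_ge0// indicE.
  split=> [fw|j lw]; move: bad1; rewrite ltNge => /negP; apply; apply: le_trans term_le.
    by rewrite [leRHS]addrC indicE mem_set// lerDr sumr_ge0// => j _; rewrite indicE.
  apply: (@le_trans _ _ (\sum_j \1_(low_avg (j :: w)) t)); last by rewrite lerDr indicE.
  apply: (@le_trans _ _ (\1_(low_avg (j :: w)) t)); first by rewrite indicE mem_set.
  have e : \sum_i \1_(low_avg (i :: w)) t = \1_(low_avg (j :: w)) t +
     \sum_(i | i != j) \1_(low_avg (i :: w)) t :> R by exact: bigD1.
  by rewrite e lerDl sumr_ge0// => i _; rewrite indicE.
set p1 := Num.sqrt 2 * expR (- (d%:R / 8)).
have p1_ge0 : 0 <= p1 by rewrite mulr_ge0 ?sqrtr_ge0 ?expR_ge0.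
have p2_ge0 : 0 <= p2 by apply: le_trans (P_few (w := [::]) isT); rewrite fine_ge0.
have Md : (M <= d)%N by apply: leq_trans KM; rewrite leq_pmull.
suff bad_le : \int[P]_t bad t <= K.+1%:R * d%:R ^+ K * (p2 + d%:R * p1) by lra.
rewrite /bad Rintegral_sum_bmeas//.
apply: (@le_trans _ _ (\sum_(k < K.+1) d%:R ^+ K * (p2 + d%:R * p1))); last first.
  by rewrite sumr_const card_ord -[leLHS]mulr_natl mulrA.
apply: ler_sum => k _; rewrite Rintegral_sum_bmeas//.
apply: (@le_trans _ _ (\sum_(w : k.-tuple 'I_M) (p2 + d%:R * p1))).
  apply: ler_sum => w _; rewrite RintegralD_bmeas//; last exact: bmeas_indic.
  rewrite Rintegral_indic// lerD//; first by apply: P_few; rewrite size_tuple.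
  rewrite Rintegral_sum_bmeas; last by move=> j; exact: bmeas_indic.
  apply: (@le_trans _ _ (\sum_(j < M) p1)).
    by apply: ler_sum => j _; rewrite Rintegral_indic//; exact: avg_field_lt.
  by rewrite sumr_const card_ord -[leLHS]mulr_natl ler_wpM2r// ler_nat.
rewrite sumr_const card_tuple card_ord -[leLHS]mulr_natl ler_wpM2r//.
  by rewrite addr_ge0// mulr_ge0.
rewrite natrX; apply: (@le_trans _ _ (d%:R ^+ k)).
  by rewrite lerXn2r ?nnegrE ?ler0n ?ler_nat.
by rewrite ler_weXn2l//; [rewrite (ler_nat R 1); lia|rewrite -ltnS].
Qed.

End Percolation.
End FreeField.

(** * Counting Gaussians above a level *)

Section Bump.
Context {R : realType}.
Implicit Types t u y : R.

Lemma sin_mvt y : 0 <= y -> exists2 c, 0 <= c <= y & sin y = cos c * y.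
Proof.
move=> y0; have dsin x : x \in `]0, y[ -> is_derive x 1 (@sin R) (cos x) by move=> _; exact: is_derive_sin.
have csin : {within `[0, y], continuous (@sin R)}.
  by apply: continuous_subspaceT; exact: continuous_sin.
have [c + e] := MVT_segment y0 dsin csin.
by rewrite in_itv/= => cy; exists c => //; move: e; rewrite sin0 !subr0.
Qed.

Lemma sqr_cos_le1 u : cos u ^+ 2 <= 1.
Proof. by rewrite -(cos2Dsin2 u) lerDl sqr_ge0. Qed.

Lemma sqr_sin_le u : sin u ^+ 2 <= u ^+ 2.
Proof.
have h y : 0 <= y -> sin y ^+ 2 <= y ^+ 2.
  move=> y0; have [c _ ->] := sin_mvt y0; by rewrite exprMn ler_piMl ?sqr_ge0// sqr_cos_le1.
have [u0|u0] := leP 0 u; first exact: h.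
by rewrite -[sin u ^+ 2]sqrrN -sinN -[u ^+ 2]sqrrN h// oppr_ge0 ltW.
Qed.

Lemma cos_ge y : 1 - y ^+ 2 / 2 <= cos y.
Proof.
have -> : cos y = 1 - 2 * sin (y / 2) ^+ 2.
  have {1}-> : y = (y / 2) *+ 2 by rewrite -mulr_natr divfK.
  by rewrite cos_mulr2n cos2sin2; ring.
by have := sqr_sin_le (y / 2); rewrite expr_div_n; lra.
Qed.

(** By the mean value theorem [sin y = cos c * y] with [0 <= c <= y <= 1], and there
    [cos c >= 1/2]. *)
Lemma sqr_sin_ge u : `|u| <= 1 -> u ^+ 2 / 4 <= sin u ^+ 2.
Proof.
have h y : 0 <= y -> y <= 1 -> y ^+ 2 / 4 <= sin y ^+ 2.
  move=> y0 y1; have [c /andP[c0 cy] ->] := sin_mvt y0; rewrite exprMn mulrC.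
  rewrite ler_wpM2r ?sqr_ge0//.
  have c1 : c ^+ 2 <= 1 by rewrite exprn_ile1// (le_trans cy).
  have hc : 2^-1 <= cos c by have := cos_ge c; lra.
  by nra.
have [u0|u0] := leP 0 u; first by rewrite ger0_norm//; exact: h.
rewrite ltr0_norm// => u1.
by rewrite -[sin u ^+ 2]sqrrN -sinN -[u ^+ 2]sqrrN h// oppr_ge0 ltW.
Qed.

Lemma cos_pow_le k u v : 0 <= v -> v <= `|u| -> `|u| <= 1 ->
  cos u ^+ (2 * k) <= expR (- (k%:R * (v ^+ 2 / 4))).
Proof.
move=> v0 vu u1; rewrite exprM -mulrN expRM_natl lerXn2r ?nnegrE ?sqr_ge0 ?expR_ge0//.
apply: le_trans (expR_ge1Dx _); rewrite cos2sin2 lerD2l lerN2.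
apply: le_trans (sqr_sin_ge u1); rewrite ler_wpM2r//.
by rewrite -[u ^+ 2]real_normK ?num_real// lerXn2r ?nnegrE.
Qed.

Lemma cos_pow_ge k u : `|u| <= 1 -> 1 - k%:R * u ^+ 2 <= cos u ^+ (2 * k).
Proof.
move=> u1; have u2 : u ^+ 2 <= 1.
  by rewrite -[u ^+ 2]real_normK ?num_real// exprn_ile1.
apply: (@le_trans _ _ ((1 - u ^+ 2) ^+ k)); first by rewrite bernoulli_ineq// sqr_ge0.
rewrite exprM lerXn2r ?nnegrE ?sqr_ge0 ?subr_ge0//.
by rewrite cos2sin2 lerD2l lerN2 sqr_sin_le.
Qed.

Context (dT : measure_display) (T : measurableType dT) (P : probability T R).

(* The trigonometric polynomial [cos (theta (t - t0)) ^ 2k] is a bump at [t0 = h + 2] of width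
   of order [1 / ln d], at most [1 / d] for [- sqrt d <= t < h + 1]. *)
Lemma few_gaussians (d : nat) (h : R) M N (X : 'I_M -> T -> R) :
  (0 < M)%N -> (M <= d)%N -> 1 <= ln d%:R :> R -> 0 <= h -> h + 2 <= Num.sqrt d%:R ->
  iid_gaussian P X ->
  fine (P [set w | (#|[pred i | (h + 1 <= X i w)%R]| < N)%N]) <=
  2 ^+ N * (1 - expR (- ((h + 3) ^+ 2 / 2)) / (24 * ln d%:R) / 2) ^+ M +
  M%:R * (Num.sqrt 2 * expR (- (d%:R / 4))).
Proof.
move=> M0 Md l1 h0 hd iidX; set l := ln d%:R in l1 *.
have d0 : (0 < d%:R :> R) by rewrite ltr0n; lia.
have dE : expR l = d%:R by rewrite lnK.
have sd0 : 0 < Num.sqrt (d%:R : R) by rewrite sqrtr_gt0.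
have sd2 : Num.sqrt (d%:R : R) ^+ 2 = d%:R by rewrite sqr_sqrtr// ltW.
(* For [- sqrt d <= t < h + 1] one has [|t - t0| <= 2 sqrt d], so the argument of the cosine stays
   in [[-1, 1]] and never meets the next period. *)
pose theta : R := (2 * Num.sqrt d%:R)^-1.
have th0 : 0 < theta by rewrite invr_gt0 mulr_gt0.
have th2 : theta ^+ 2 = (4 * d%:R)^-1.
  by rewrite exprVn exprMn sd2; congr (_ * _)^-1; ring.
have thd : theta * Num.sqrt d%:R = 2^-1.
  by rewrite /theta; field; rewrite gt_eqF.
(* Chosen so that [k * theta^2 / 4 = k / (16 d) >= ln d]: at distance 1 from [t0] the bump has
   fallen to [1 / d]. *)
pose k := (Num.truncn (16 * d%:R * l)).+1.
have [k1 k2] : 16 * d%:R * l <= k%:R /\ k%:R <= 16 * d%:R * l + 1.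
  have kl0 : 0 <= 16 * d%:R * l by rewrite mulr_ge0 ?mulr_ge0//; lra.
  have /andP[t1 t2] := truncn_itv kl0.
  by split; [exact: ltW|rewrite /k -natr1 lerD2r].
pose t0 := h + 2.
have [L LE] := trigpoly_cosX theta (- (theta * t0)) (2 * k).
have {}LE t : trigpoly L t = cos (theta * (t - t0)) ^+ (2 * k) by rewrite LE mulrBr.
have L01 t : 0 <= trigpoly L t <= 1.
  rewrite LE exprM exprn_ge0 ?sqr_ge0//= exprn_ile1 ?sqr_ge0//.
(* On [[t0, t0 + s]] one has [k * (theta * u)^2 <= 1/2], so the bump is at least 1/2 there. Together
   with the density bound this yields [q], where [24 = 2 * 4 * 3]. *)
pose s : R := (4 * l)^-1.
have l0 : 0 < l by lra.
have s0 : 0 < s by rewrite invr_gt0 mulr_gt0.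
have s1 : s <= 1 by rewrite invf_le1 ?mulr_gt0//; lra.
set q := expR _ / _.
have q0 : 0 <= q by rewrite divr_ge0 ?expR_ge0//; lra.
have qE : q <= 2^-1 * (s * expR (- ((t0 + s) ^+ 2 / 2)) / 3).
  have -> : q = 2^-1 * (s * expR (- ((h + 3) ^+ 2 / 2)) / 3).
    by rewrite /q /s; field; rewrite gt_eqF.
  rewrite ler_wpM2l ?invr_ge0// ler_wpM2r ?invr_ge0// ler_wpM2l ?(ltW s0)// ler_expR lerN2.
  rewrite ler_wpM2r ?invr_ge0// lerXn2r ?nnegrE /t0; lra.
have qL : q <= gauss_mean L.
  apply: le_trans qE _; pose i0 := Ordinal M0.
  have g0 := iid_gaussian_rv iidX i0.
  rewrite -(Rintegral_trigpoly iidX L i0).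
  have mA : measurable (X i0 @^-1` `[t0, t0 + s]%classic).
    by rewrite -[X in measurable X]setTI; have [mX _] := g0; apply: mX => //; exact: measurable_itv.
  apply: (@le_trans _ _ (2^-1 * fine (P (X i0 @^-1` `[t0, t0 + s]%classic)))).
    by rewrite ler_wpM2l ?invr_ge0//; apply: gaussian_rv_itv => //; rewrite /t0; lra.
  apply: fine_prob_ge => //; first exact: (bmeas_trigpoly iidX).
    by move=> w; have /andP[] := L01 (X i0 w).
  move=> w /=; rewrite in_itv/= => /andP[w1 w2]; rewrite LE.
  set u := X i0 w - t0.
  have u0 : 0 <= u by rewrite subr_ge0.
  have us : u <= s by rewrite lerBlDl.
  have th1 : theta <= 1.
    rewrite invf_le1 ?mulr_gt0//; have : 2 <= Num.sqrt (d%:R : R) by lra.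
    lra.
  apply: le_trans (cos_pow_ge k _); last first.
    by rewrite ger0_norm ?mulr_ge0 ?(ltW th0)//; nra.
  have : k%:R * (theta * u) ^+ 2 <= 2^-1.
    rewrite exprMn th2.
    apply: (@le_trans _ _ ((16 * d%:R * l + 1) * ((4 * d%:R)^-1 * s ^+ 2))).
      rewrite ler_pM// ?mulr_ge0 ?invr_ge0 ?sqr_ge0//.
      by rewrite ler_wpM2l ?invr_ge0// lerXn2r ?nnegrE ?(ltW s0).
    have -> : (16 * d%:R * l + 1) * ((4 * d%:R)^-1 * s ^+ 2) = (16 * d%:R * l + 1) / (64 * d%:R * l ^+ 2).
      by rewrite /s; field; rewrite !gt_eqF.
    rewrite ler_pdivrMr ?mulr_gt0 ?exprn_gt0//.
    have d1 : 1 <= d%:R :> R by rewrite (ler_nat R 1) (leq_trans M0 Md).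
    have dl : 1 <= d%:R * l by rewrite mulr_ege1.
    have dl2 : d%:R * l <= d%:R * l ^+ 2 by rewrite ler_wpM2l// expr2 ler_peMl// ltW.
    by move: dl dl2; clear; lra.
  by clear; lra.
have small t : - Num.sqrt d%:R <= t -> t < h + 1 -> trigpoly L t <= M%:R^-1.
  move=> t1 t2; rewrite LE.
  have u1 : theta <= `|theta * (t - t0)|.
    rewrite normrM (gtr0_norm th0) ler_peMr ?(ltW th0)// ltr0_norm /t0; lra.
  have u2 : `|theta * (t - t0)| <= 1.
    rewrite normrM (gtr0_norm th0) ltr0_norm /t0; last by lra.
    apply: (@le_trans _ _ (theta * (2 * Num.sqrt d%:R))); last by rewrite mulrCA thd; lra.
    by rewrite ler_wpM2l ?(ltW th0)//; lra.
  apply: le_trans (cos_pow_le k (ltW th0) u1 u2) _.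
  apply: (@le_trans _ _ (expR (- l))).
    rewrite ler_expR lerN2 th2.
    apply: (@le_trans _ _ (16 * d%:R * l * ((4 * d%:R)^-1 / 4))); last by rewrite ler_wpM2r ?divr_ge0 ?invr_ge0.
    by rewrite (_ : _ * _ = l)//; field; rewrite gt_eqF.
  have Mp : 0 < M%:R :> R by rewrite ltr0n.
  have MdR : M%:R <= d%:R :> R by rewrite ler_nat.
  by rewrite expRN dE lef_pV2.
have q1 : q <= 1.
  apply: le_trans qL _; rewrite -(Rintegral_trigpoly iidX L (Ordinal M0)) -(Rintegral_1 P).
  apply: le_Rintegral_bmeas; [exact: (bmeas_trigpoly iidX)|exact: bmeas_cst|].
  by move=> w; have /andP[] := L01 (X (Ordinal M0) w).
have := few_large_prob iidX N M0 L01 small qL q1 sd0.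
by rewrite sd2.
Qed.

End Bump.

(** * Choice of parameters *)

Section Numerics.
Context {R : realType}.

(** Every prefactor is the exponential of a multiple of [l], up to constants. The lower bound on
    [sqrt l] makes [D = d ^ eps] exceed all these multiples. *)
Lemma perc_numerics (eps l h : R) (d K M N : nat) :
  0 < eps -> eps < 1 / 3 -> l = ln d%:R -> 40 * K.+1%:R / eps <= Num.sqrt l -> (0 < d)%N ->
  M = (d %/ K.+1)%N -> N%:R <= d%:R `^ eps + 1 ->
  0 <= h -> h <= Num.sqrt (2 * (1 + 2 / d%:R) * l) * (1 - 2 * eps) ->
  [/\ (20 <= d)%N, (0 < M)%N, 1 <= l, h + 2 <= Num.sqrt d%:R &
   K.+1%:R * d%:R ^+ K * ((2 ^+ N * (1 - expR (- ((h + 3) ^+ 2 / 2)) / (24 * l) / 2) ^+ M +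
      M%:R * (Num.sqrt 2 * expR (- (d%:R / 4)))) + d%:R * (Num.sqrt 2 * expR (- (d%:R / 8)))) <=
   2 * expR (- d%:R `^ eps)].
Proof.
move=> e0 e1 lE; set k := K.+1%:R; set s := Num.sqrt l => sbig d0 ME ND h0 hle.
have k1 : 1 <= k by rewrite (ler_nat R 1).
have kK : K%:R + 1 = k by rewrite natr1.
have d0R : 0 < d%:R :> R by rewrite ltr0n.
have dE : d%:R = expR l by rewrite lE lnK.
have s0 : 0 <= s by exact: sqrtr_ge0.
have se : 40 * k <= s * eps by rewrite -ler_pdivrMr.
have sk : 40 * 3 * k <= s by move: se e0 e1 s0; clear; nra.
have s1 : 40 * 3 <= s by move: sk k1; clear; lra.
have l_ge0 : 0 <= l.
  have [//|/ltW l_le0] := leP 0 l.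
  by move: s1; rewrite /s ler0_sqrtr//; clear; lra.
have s2 : s ^+ 2 = l by rewrite sqr_sqrtr.
have sl : 40 * s <= l by rewrite -s2; move: s1; clear; nra.
have ld : l + 1 <= d%:R by rewrite dE addrC expR_ge1Dx.
have d20 : (20 <= d)%N by rewrite -(ler_nat R); move: sl ld s1; clear; lra.
have kd : 2 * k <= d%:R by move: sk sl ld s0 k1; clear; lra.
have K1d : (K.+1 <= d)%N by rewrite -(ler_nat R); move: kd k1; rewrite -/k; clear; lra.
have M0 : (0 < M)%N by rewrite ME divn_gt0.
set D := d%:R `^ eps in ND *.
have DE : D = expR (eps * l) by rewrite /D /powR gt_eqF// lE.
have el0 : 0 <= eps * l by exact: mulr_ge0 (ltW e0) l_ge0.
(* The quadratic term of the exponential suffices: [(eps l)^2 / 2 >= 800 k l]. The constant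
   [12 * 24 = 3 * 48 * 2] is what [qM] consumes. *)
have Dl : 12 * 24 * (k * l) <= D.
  rewrite DE; apply: le_trans (expR_ge1Dxn 1 el0).
  have -> : 2`!%:R = 2 :> R by [].
  have -> : (eps * l) ^+ 2 = (s * eps) ^+ 2 * l by rewrite -s2; ring.
  have h1 : (40 * k) ^+ 2 <= (s * eps) ^+ 2.
    by rewrite lerXn2r ?nnegrE//; move: se k1; clear; lra.
  have h2 : 40 * 40 * k <= (s * eps) ^+ 2.
    by apply: le_trans h1; move: k1; clear; nra.
  have h3 : 40 * 40 * k * l <= (s * eps) ^+ 2 * l by rewrite ler_wpM2r.
  have h4 : 0 <= k * l by rewrite mulr_ge0//; move: k1; clear; lra.
  by move: h3 h4; rewrite -!mulrA; clear; lra.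
have lkl : l <= k * l by rewrite ler_peMl.
have l1 : 1 <= l by move: s1 sl; clear; lra.
have Dl2 : 12 * 24 * l <= D by move: Dl lkl; clear; lra.
have D1 : 1 <= D by move: Dl2 l1; clear; lra.
have D3 : D ^+ 3 <= d%:R.
  rewrite DE dE -expRM_natl ler_expR mulrA -[leRHS]mul1r ler_wpM2r//.
  by move: e1; clear; lra.
have D2d : D ^+ 2 <= d%:R by apply: le_trans D3; rewrite ler_weXn2l.
have Dsd : D <= Num.sqrt d%:R.
  by rewrite -[D]ger0_norm ?(le_trans ler01)// -sqrtr_sqr ler_wsqrtr.
have hd2 : 2 / d%:R <= 1 :> R by rewrite ler_pdivrMr//; move: ld l1; clear; lra.
have hd0 : 0 <= 2 / d%:R :> R by rewrite divr_ge0.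
have hs : h <= 2 * s.
  apply: le_trans hle _; apply: (@le_trans _ _ (Num.sqrt (2 * (1 + 2 / d%:R) * l))).
    by rewrite ler_piMr ?sqrtr_ge0//; move: e0; clear; lra.
  have -> : 2 * s = Num.sqrt (4 * l).
    rewrite (_ : 4 * l = (2 * s) ^+ 2); last by rewrite exprMn s2; ring.
    by rewrite sqrtr_sqr ger0_norm// mulr_ge0.
  by rewrite ler_wsqrtr// ler_wpM2r//; move: hd2; clear; lra.
have hsd : h + 2 <= Num.sqrt d%:R.
  by apply: le_trans Dsd; apply: le_trans Dl2; move: hs sl s1; clear; lra.
split=> //.
have h2 : h ^+ 2 <= 2 * (1 + 2 / d%:R) * l * (1 - 2 * eps) ^+ 2.
  have -> : 2 * (1 + 2 / d%:R) * l = Num.sqrt (2 * (1 + 2 / d%:R) * l) ^+ 2.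
    by rewrite sqr_sqrtr// mulr_ge0// mulr_ge0// addr_ge0.
  rewrite -exprMn lerXn2r ?nnegrE// mulr_ge0 ?sqrtr_ge0//.
  by move: e1; clear; lra.
have h3 : h ^+ 2 <= 2 * l * (1 - 8 / 3 * eps) + 4.
  apply: le_trans h2 _.
  (* For [eps >= 0] this amounts to [eps <= 1/3]. *)
  have he : (1 - 2 * eps) ^+ 2 <= 1 - 8 / 3 * eps by move: e0 e1; clear; nra.
  have he1 : (1 - 2 * eps) ^+ 2 <= 1 by move: e0 e1; clear; nra.
  have hld : 2 / d%:R * l <= 2 by rewrite mulrAC ler_pdivrMr//; move: ld; clear; lra.
  have hld0 : 0 <= 2 / d%:R * l by rewrite mulr_ge0.
  have -> : 2 * (1 + 2 / d%:R) * l * (1 - 2 * eps) ^+ 2 =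
    2 * l * (1 - 2 * eps) ^+ 2 + 2 * (2 / d%:R * l * (1 - 2 * eps) ^+ 2) by ring.
  apply: lerD; first by rewrite ler_wpM2l// mulr_ge0.
  have : 2 / d%:R * l * (1 - 2 * eps) ^+ 2 <= 2 * 1 by rewrite ler_pM// sqr_ge0.
  by clear; lra.
(* The cross term [3 h <= 6 s] and the constants fit into [8 s], which the surplus [8/3 - 2 = 2/3]
   in the coefficient of [eps * l] pays for. *)
have h4 : (h + 3) ^+ 2 / 2 <= l - 2 * (eps * l).
  have hsl : 8 * s <= 2 / 3 * (eps * l).
    rewrite -s2; move: se k1 s0; clear => se k1 s0.
    have : s * 40 <= s * (s * eps) by rewrite ler_wpM2l//; lra.
    by rewrite !expr2; nra.
  by move: h3 hs hsl s1; clear; nra.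
set E := expR (- ((h + 3) ^+ 2 / 2)).
have E_ge : D ^+ 2 <= E * d%:R.
  rewrite DE dE -expRM_natl -expRD ler_expR.
  by move: h4; clear; lra.
have E0 : 0 <= E by exact: expR_ge0.
have E1 : E <= 1.
  by rewrite -expR0 ler_expR oppr_le0 divr_ge0 ?sqr_ge0.
set q := E / (24 * l) / 2.
have l24 : 0 < 24 * l by move: l1; clear; lra.
have q0 : 0 <= q by rewrite !divr_ge0// ltW.
have q1 : q <= 1.
  by rewrite /q ler_pdivrMr// ler_pdivrMr//; move: E1 l1; clear; lra.
have Mk : d%:R <= M%:R * (2 * k).
  have : (d <= M * K.+1 + K.+1)%N.
    by rewrite {1}(divn_eq d K.+1) ME leq_add2l ltnW// ltn_mod.
  rewrite -(ler_nat R) natrD natrM -/k.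
  by move: kd; clear; lra.
(* Of the three copies of [D], one pays for [2 ^ N], one for the prefactor [k * d ^ K], and one is
   left for the conclusion. *)
have qM : 3 * D <= q * M%:R.
  rewrite /q -!mulrA.
  have -> : E * ((24 * l)^-1 * (2^-1 * M%:R)) = E * M%:R / (12 * 4 * l).
    by field; rewrite gt_eqF//; move: l1; clear; lra.
  rewrite ler_pdivlMr; last by move: l1; clear; lra.
  have : E * d%:R <= E * (M%:R * (2 * k)) by rewrite ler_wpM2l.
  move/(le_trans E_ge) => hE.
  have k0 : 0 < 2 * k by move: k1; clear; lra.
  rewrite -(ler_pM2r k0) -[leRHS]mulrA; apply: le_trans hE.
  have -> : 3 * D * (12 * 4 * l) * (2 * k) = D * (12 * 24 * (k * l)) by ring.
  by rewrite expr2 ler_wpM2l//; move: D1; clear; lra.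
have t1 : (1 - q) ^+ M <= expR (- (3 * D)).
  apply: (@le_trans _ _ (expR (- q) ^+ M)).
    by rewrite lerXn2r ?nnegrE ?expR_ge0 ?subr_ge0// expR_ge1Dx.
  by rewrite -expRM_natr ler_expR mulNr lerN2.
have two_e : 2 <= expR 1 :> R by apply: le_trans (expR_ge1Dx 1); clear; lra.
have t2 : 2 ^+ N <= expR (D + 1) :> R.
  apply: (@le_trans _ _ (expR 1 ^+ N)); first by rewrite lerXn2r ?nnegrE ?expR_ge0.
  by rewrite -expRM_natr mul1r ler_expR.
have tk : k <= expR k by apply: le_trans (expR_ge1Dx k); clear; lra.
have td : d%:R ^+ K = expR (K%:R * l) by rewrite dE -expRM_natl.
have Kl : K%:R * l + l = k * l by rewrite -kK mulrDl mul1r.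
have kl : k <= k * l by rewrite ler_peMr//; move: k1; clear; lra.
have Kl0 : 0 <= K%:R * l by rewrite mulr_ge0.
have first : k * d%:R ^+ K * (2 ^+ N * (1 - q) ^+ M) <= expR (- D).
  apply: (@le_trans _ _ (expR k * expR (K%:R * l) * (expR (D + 1) * expR (- (3 * D))))).
    rewrite td; apply: ler_pM; rewrite ?mulr_ge0 ?exprn_ge0 ?expR_ge0 ?subr_ge0//.
    - by rewrite ler_wpM2r ?expR_ge0.
    - by rewrite ler_pM ?exprn_ge0 ?subr_ge0.
  rewrite -!expRD ler_expR.
  by move: Dl lkl kl Kl l1; clear; lra.
have sqrt2 : Num.sqrt 2 <= 2 :> R.
  have {2}-> : 2 = Num.sqrt (2 ^+ 2) :> R by rewrite sqrtr_sqr ger0_norm.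
  by rewrite ler_wsqrtr// expr2; clear; lra.
have Md : M%:R <= d%:R :> R by rewrite ler_nat ME leq_div.
have second : k * d%:R ^+ K * (M%:R * (Num.sqrt 2 * expR (- (d%:R / 4))) + d%:R * (Num.sqrt 2 * expR (- (d%:R / 8)))) <= expR (- D).
  have dd : expR (- (d%:R / 4)) <= expR (- (d%:R / 8)) :> R.
    by rewrite ler_expR; move: d0R; clear; lra.
  have hx : M%:R * (Num.sqrt 2 * expR (- (d%:R / 4))) + d%:R * (Num.sqrt 2 * expR (- (d%:R / 8)))
      <= d%:R * (expR 1 * (expR 1 * expR (- (d%:R / 8)))) :> R.
    apply: (@le_trans _ _ (d%:R * (2 * expR (- (d%:R / 8))) + d%:R * (2 * expR (- (d%:R / 8))))).
      apply: lerD.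
        by rewrite ler_pM ?mulr_ge0 ?sqrtr_ge0 ?expR_ge0// ler_pM ?sqrtr_ge0 ?expR_ge0.
      by rewrite ler_wpM2l// ler_wpM2r ?expR_ge0.
    rewrite -mulrDr ler_wpM2l// -mulr2n -[leLHS]mulr_natl.
    by rewrite ler_pM ?mulr_ge0 ?expR_ge0// ler_wpM2r ?expR_ge0.
  apply: (@le_trans _ _ (expR k * expR (K%:R * l) * (expR l * (expR 1 * (expR 1 * expR (- (d%:R / 8))))))).
    rewrite td; apply: ler_pM; rewrite ?mulr_ge0 ?addr_ge0 ?mulr_ge0 ?sqrtr_ge0 ?expR_ge0//.
    - by rewrite ler_wpM2r ?expR_ge0.
    - by rewrite -dE.
  rewrite -!expRD ler_expR.
  have Dd : 8 * (2 * D) <= d%:R.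
    apply: le_trans D2d; rewrite expr2 mulrA ler_wpM2r//; move: Dl2 l1 D1; clear; lra.
  by move: Dl lkl kl Kl l1 Dd; clear; lra.
rewrite -addrA mulrDr [2 * _]mulr_natl mulr2n; exact: lerD.
Qed.
End Numerics.

Unset Implicit Arguments.

Theorem theorem4p4 (R : realType) (eps : R) :
  0 < eps -> eps < 1 / 3 ->
  exists c c' : R, 0 < c /\ 0 < c' /\
    forall (d : nat) (dT : measure_display) (T : measurableType dT)
      (P : probability T R) (phi : zpoint d -> {RV P >-> R}),
      (3 <= d)%N -> is_GFF phi ->
      forall x : zpoint d, in_cube x ->
        ((1 - c * expR (- c' * (d%:R `^ eps)))%:E <=
         P [set w | exists y : zpoint d, nbr x y /\
             exists C : seq (zpoint d), y \in C /\
               substantial eps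
                 (fun z => in_cube z && (h_as R d * (1 - 2 * eps) <= phi z w)%R) C])%E.
Proof.
move=> e0 e1.
(* An integer at least [11 / eps = bconst eps - 1], the exponent in the definition of a substantial
   component. *)
pose K := (Num.truncn (11 / eps)).+1.
have K11 : 11 / eps <= K%:R.
  have /truncn_itv/andP[_ /ltW//] : 0 <= 11 / eps by rewrite divr_ge0// ltW.
pose s := 40 * K.+1%:R / eps.
pose B := expR (eps * s ^+ 2).
exists (2 + expR B), 1; split; first by rewrite addr_gt0// expR_gt0.
split=> // d dT T P phi d3 gff x cx.
have d0 : (0 < d)%N by lia.
have d0R : 0 < d%:R :> R by rewrite ltr0n.
pose l : R := ln d%:R.
have s120 : 40 * 3 <= s.
  rewrite /s ler_pdivlMr//; have : 1 <= K.+1%:R :> R by rewrite (ler_nat R 1).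
  by move: e0 e1; clear; lra.
set D := d%:R `^ eps; rewrite mulN1r.
have DE : D = expR (eps * l) by rewrite /D /powR gt_eqF.
(* When [sqrt (ln d) < s], one has [d ^ eps <= B]; the term [expR B] of the constant then makes the
   lower bound nonpositive. *)
have [sl|sl] := leP s (Num.sqrt l); last first.
  apply: (@le_trans _ _ 0%E) => //; rewrite lee_fin subr_le0.
  have DB : D <= B.
    rewrite DE ler_expR ler_wpM2l ?(ltW e0)//.
    have [l_le0|l_gt0] := leP l 0; first by apply: le_trans l_le0 (sqr_ge0 _).
    by rewrite -(sqr_sqrtr (ltW l_gt0)) lerXn2r ?nnegrE ?sqrtr_ge0 ?(ltW sl)// (le_trans _ s120).
  apply: (@le_trans _ _ (expR B * expR (- D))).
    by rewrite -expRD -[leLHS]expR0 ler_expR subr_ge0.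
  by rewrite ler_wpM2r ?expR_ge0// lerDr.
have l_ge : 20 <= l.
  have l0 : 0 <= l.
    have [//|/ltW l_le0] := leP 0 l.
    by move: sl s120; rewrite ler0_sqrtr//; clear; lra.
  by rewrite -(sqr_sqrtr l0) expr2; move: sl s120; clear; nra.
have d20 : (20 <= d)%N.
  by rewrite -(ler_nat R); move: (ln_sublinear d0R) l_ge; rewrite -/l; clear; lra.
pose N := (Num.truncn D).+1.
have D0 : 0 <= D by exact: powR_ge0.
have [ND1 ND2] : D <= N%:R /\ N%:R <= D + 1.
  have /andP[t1 t2] := truncn_itv D0.
  by split; [exact: ltW|rewrite /N -natr1 lerD2r].
pose M := (d %/ K.+1)%N.
have KM : (K.+1 * M <= d)%N by rewrite mulnC leq_trunc_div.
(* The base is at most [D <= N] because [bconst eps >= 1], and the exponent is at most [K]. *)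
have substN : (Num.floor (D / bconst eps))%:~R `^ (bconst eps - 1) <= (N ^ K)%:R :> R.
  have b1 : 1 <= bconst eps by rewrite /bconst lerDl divr_ge0// ltW.
  have -> : bconst eps - 1 = 11 / eps by rewrite /bconst addrAC subrr add0r.
  have Db0 : 0 <= D / bconst eps by rewrite divr_ge0// (le_trans ler01).
  have fl0 : 0 <= (Num.floor (D / bconst eps))%:~R :> R by rewrite ler0z floor_ge0.
  have flN : (Num.floor (D / bconst eps))%:~R <= N%:R :> R.
    apply: le_trans (floor_le _) _; apply: le_trans ND1.
    by rewrite ler_pdivrMr ?(lt_le_trans ltr01)// ler_peMr.
  apply: (@le_trans _ _ (N%:R `^ (11 / eps))).
    by apply: ge0_ler_powR; rewrite ?nnegrE// divr_ge0// ltW.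
  apply: (@le_trans _ _ (N%:R `^ K%:R)); first by apply: ler_powR => //; rewrite (ler_nat R 1).
  by rewrite powR_mulrn// natrX.
have green1 := @green_le R d d20 (origin d) (origin d).
have e2 : 0 <= 1 - 2 * eps by move: e1; clear; lra.
pose h := h_as R d * (1 - 2 * eps).
have h0 : 0 <= h by rewrite mulr_ge0// sqrtr_ge0.
have hle : h <= Num.sqrt (2 * (1 + 2 / d%:R) * l) * (1 - 2 * eps).
  rewrite /h /h_as ler_wpM2r// ler_wsqrtr// ler_wpM2r//; last by rewrite ler_wpM2l.
  by move: l_ge; rewrite -/l; clear; lra.
have [_ M0 l1 hd num] := perc_numerics e0 e1 erefl sl d0 (erefl M) ND2 h0 hle.
have Md : (M <= d)%N by rewrite leq_div.
have p2P (X : 'I_M -> T -> R) : iid_gaussian P X -> _ :=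
  @few_gaussians R dT T P d h M N X M0 Md l1 h0 hd.
have := perc_event_prob gff d20 cx KM (ltn0Sn _ : (0 < N)%N) substN p2P.
have -> : [set w | exists y : zpoint d, nbr x y /\
    exists C : seq (zpoint d), y \in C /\
      substantial eps (fun z => in_cube z && (h_as R d * (1 - 2 * eps) <= phi z w)%R) C] =
  perc_event phi x eps h by [].
move=> prob; rewrite -[leRHS]fineK; last first.
  rewrite ge0_fin_numE// (le_lt_trans (probability_le1 P _)) ?ltry//.
  exact: measurable_perc_event.
rewrite lee_fin; apply: le_trans prob; rewrite lerD2l lerN2; apply: le_trans num _.
by rewrite ler_wpM2r ?expR_ge0// lerDl expR_ge0.
Qed.
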